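(* Let $\mathcal A_{\mathbb E}$ be the elliptic arrangement in $\mathbb E^d$ defined by $A$ and $b$, and let $\mathcal K$ be the associated acyclic category. Then there is a homotopy equivalence $$\lVert \mathcal K\rVert \simeq M(\mathcal A_{\mathbb E}).$$
   Context: **Arrangements.** Fix $\omega\in\mathbb C\setminus\mathbb R$ and let $\mathbb E=\mathbb C/\langle 1,\omega\rangle$ be the quotient by the lattice $\mathbb Z+\mathbb Z\omega$. Identify $S^1$ with $\mathbb R/\mathbb Z$, written additively. Let $A\in\mathbb Z^{d\times n}$ be an integer matrix of rank $d$ with nonzero columns $a_1,\dots,a_n$ (write $a_{j,k}$ for the $k$-th entry of $a_j$), and let $b_1,\dots,b_n\in\mathbb R/\mathbb Z$. Put $$\mathbf H_j=\Big\{z\in\mathbb E^d \,\Big|\, \sum_k a_{j,k}z_k=b_j+\omega b_j\Big\}\subseteq\mathbb E^d,\qquad H_j=\Big\{x\in(S^1)^d\,\Big|\,\sum_k a_{j,k}x_k=b_j\Big\}\subseteq (S^1)^d .$$ The toric arrangement is $\mathcal A=\{H_1,\dots,H_n\}$, the elliptic arrangement is $\mathcal A_{\mathbb E}=\{\mathbf H_1,\dots,\mathbf H_n\}$, and $M(\mathcal A_{\mathbb E})=\mathbb E^d\setminus\bigcup_j\mathbf H_j$. **Face category $\mathcal F$ of the toric arrangement.** Let $\mathcal A^{\upharpoonright}$ be the locally finite, $\mathbb Z^d$-periodic arrangement of all affine hyperplanes in $\mathbb R^d$ that are connected components of preimages of the $H_j$ under $\mathbb R^d\to(\mathbb R/\mathbb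 Z)^d=(S^1)^d$. It subdivides $\mathbb R^d$ into relatively open faces whose closures are polytopes, and $\mathbb Z^d$ acts freely on the set of faces by translation. The category $\mathcal F=\mathcal F(\mathcal A)$ (the face category of the induced polyhedral CW structure $K_{\mathcal A}$ on $(S^1)^d$) has as objects the $\mathbb Z^d$-orbits of faces of $\mathcal A^{\upharpoonright}$ (equivalently, the open cells of $K_{\mathcal A}$, i.e. the images of faces in $(S^1)^d$); morphisms $F\to G$ are the $\mathbb Z^d$-orbits of pairs $(P,Q)$ of faces with $P$ in the orbit $F$, $Q$ in the orbit $G$, and $P\subseteq\overline Q$; composition is induced by transitivity of the relation $P\subseteq\overline{Q}$. For an object $F$ let $\operatorname{supp}(F)=\{H\in\mathcal A\mid F\subseteq H\}$. **The category $\mathcal K$.** Its objects are the pairs $(F,G)$ of objects of $\mathcal F$ with $\operatorname{supp}(F)\cap\operatorname{supp}(G)=\emptyset$; its morphisms $(F_1,G_1)\to(F_2,G_2)$ are the pairs $(\alpha,\beta)$ with $\alpha\in\operatorname{Mor}_{\mathcal F^{op}}(F_1,F_2)$, $\beta\in\operatorname{Mor}_{\mathcal F^{op}}(G_1,G_2)$, composed componentwise. **Geometric realization.** An acyclic category is a small category in which the only invertible morphisms are endomorphisms and the only endomorphisms are identities. Its geometric realization $\lVert\mathcal C\rVert$ is the space glued from one vertex for each object and one $m$-simplex for each composable chain $(\phi_1,\dots,\phi_m)$ of $m\ge1$ non-identity morphisms, whose faces are glued to the simplices of the chains obtained by dropping $\phi_1$, dropping $\phi_m$, or composing two consecutive morphisms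 (for $m=1$, the endpoints are the source and target of $\phi_1$). *)

(* Defs.v *)
From HB Require Import structures.
From mathcomp Require Import all_boot all_order all_algebra.
From mathcomp Require Import all_classical all_reals topology normedtype realfun.
From mathcomp Require Import complex ring lra.
From Stdlib Require Import Relation_Operators.

Set Implicit Arguments.
Unset Strict Implicit.
Unset Printing Implicit Defensive.

Import Order.TTheory GRing.Theory Num.Theory.
Import numFieldNormedType.Exports.

Local Open Scope classical_set_scope.
Local Open Scope ring_scope.
Local Open Scope quotient_scope.

Section Homotopy.
Variable R : realType.

Definition homotopic (X Y : topologicalType) (f g : X -> Y) : Prop :=
  exists H : X * R -> Y,
    [/\ {within [set: X] `*` `[0%R, 1%R], continuous H},
        forall x, H (x, 0) = f x & forall x, H (x, 1) = g x].

Definition homotopy_equivalent (X Y : topologicalType) : Prop :=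
  exists (f : X -> Y) (g : Y -> X),
    [/\ continuous f, continuous g,
        homotopic (g \o f) id & homotopic (f \o g) id].

End Homotopy.

(* [comp f g] is "[f] followed by [g]". *)
Record category := Category {
  ob :> Type;
  hom : ob -> ob -> Type;
  idm : forall x, hom x x;
  comp : forall x y z, hom x y -> hom y z -> hom x z;
  comp1m : forall x y (f : hom x y), comp (idm x) f = f;
  compm1 : forall x y (f : hom x y), comp f (idm y) = f;
  compA : forall x y z t (f : hom x y) (g : hom y z) (h : hom z t),
    comp f (comp g h) = comp (comp f g) h }.

Arguments hom {c}.
Arguments idm {c}.
Arguments comp {c x y z}.

Definition acyclic (C : category) : Prop :=
  (forall (x y : C) (f : hom x y) (g : hom y x),
     comp f g = idm x -> comp g f = idm y -> x = y) /\
  (forall (x : C) (f : hom x x), f = idm x).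

Definition opposite (C : category) : category :=
  @Category C (fun x y => hom y x) (fun x => idm x)
    (fun x y z f g => comp g f)
    (fun x y f => compm1 f) (fun x y f => comp1m f)
    (fun x y z t f g h => esym (compA h g f)).

Section ProductCategory.
Variables C D : category.

Let phom (p q : C * D) : Type := (hom p.1 q.1 * hom p.2 q.2)%type.
Let pid (p : C * D) : phom p p := (idm p.1, idm p.2).
Let pcomp (p q r : C * D) (f : phom p q) (g : phom q r) : phom p r :=
  (comp f.1 g.1, comp f.2 g.2).

Fact pcomp1m p q (f : phom p q) : pcomp (pid p) f = f.
Proof. by case: f => f1 f2; rewrite /pcomp /= !comp1m. Qed.

Fact pcompm1 p q (f : phom p q) : pcomp f (pid q) = f.
Proof. by case: f => f1 f2; rewrite /pcomp /= !compm1. Qed.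

Fact pcompA p q r s (f : phom p q) (g : phom q r) (h : phom r s) :
  pcomp f (pcomp g h) = pcomp (pcomp f g) h.
Proof. by rewrite /pcomp /= !compA. Qed.

Definition product_category : category := Category pcomp1m pcompm1 pcompA.

End ProductCategory.

Definition full_subcategory (C : category) (P : C -> Prop) : category :=
  @Category {x : C | P x} (fun x y => hom (sval x) (sval y))
    (fun x => idm (sval x)) (fun x y z f g => comp f g)
    (fun x y f => comp1m f) (fun x y f => compm1 f)
    (fun x y z t f g h => compA f g h).

Lemma acyclic_opposite C : acyclic C -> acyclic (opposite C).
Proof.
move=> [iC eC]; split=> [x y f g fg gf|x f]; last exact: eC.
exact: (iC x y g f).
Qed.

Lemma acyclic_product C D :
  acyclic C -> acyclic D -> acyclic (product_category C D).
Proof.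
move=> [iC eC] [iD eD]; split=> [[x x'] [y y'] [f f'] [g g'] [fg fg'] [gf gf']|].
  by rewrite (iC x y f g fg gf) (iD x' y' f' g' fg' gf').
by move=> [x x'] [f f']; rewrite (eC x f) (eD x' f').
Qed.

Lemma acyclic_full (C : category) (P : C -> Prop) :
  acyclic C -> acyclic (full_subcategory P).
Proof.
move=> [iC eC]; split=> [[x Px] [y Py] f g fg gf|[x Px] f]; last exact: eC.
by move: (iC x y f g fg gf) => /= xy; exact: eq_exist.
Qed.

Section Chains.
Variable C : category.

Definition arrow := {x : C & {y : C & hom x y}}.
Definition Arrow (x y : C) (f : hom x y) : arrow :=
  existT _ x (existT _ y f).
Definition source (a : arrow) : C := projT1 a.
Definition target (a : arrow) : C := projT1 (projT2 a).
Definition is_identity (a : arrow) : Prop := exists x : C, a = Arrow (idm x).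
Definition is_composite (a b ab : arrow) : Prop :=
  exists (x y z : C) (f : hom x y) (g : hom y z),
    [/\ a = Arrow f, b = Arrow g & ab = Arrow (comp f g)].

Fixpoint composable (x : C) (s : seq arrow) : Prop :=
  if s is a :: s' then
    [/\ source a = x, ~ is_identity a & composable (target a) s']
  else True.

(* The object [x] is kept along with the arrows so that chains of length 0 are
   the objects of [C]. *)
Definition chain := {xs : C * seq arrow | composable xs.1 xs.2}.
Definition dim (c : chain) : nat := size (sval c).2.

(* [chain_face i c c']: [c'] is the face of [c] opposite to its [i]-th vertex,
   the vertices of (x, a_1 ... a_m) being x and the targets of the a_k. *)
Inductive chain_face : nat -> C * seq arrow -> C * seq arrow -> Prop :=
| Drop_first x a s : chain_face 0 (x, a :: s) (target a, s)
| Drop_last x s a : chain_face (size s).+1 (x, rcons s a) (x, s)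
| Compose x s a b ab s' : is_composite a b ab ->
    chain_face (size s).+1 (x, s ++ [:: a, b & s']) (x, s ++ ab :: s').

HB.instance Definition _ := gen_eqMixin chain.
HB.instance Definition _ := gen_choiceMixin chain.

End Chains.

Section Realization.
Variables (R : realType) (C : category).

Definition std_simplex (m : nat) : set 'rV[R]_m.+1 :=
  [set t | (forall k, 0 <= t 0 k) /\ \sum_k t 0 k = 1].
Arguments std_simplex m : clear implicits.

Definition simplex_of (c : chain C) : topologicalType := std_simplex (dim c).
Definition simplices := {c : chain C & simplex_of c}.

(* [k]-th barycentric coordinate, extended by 0 to all natural numbers. *)
Definition coord (p : simplices) (k : nat) : R :=
  oapp ((val (projT2 p) : 'rV[R]_(dim (projT1 p)).+1) 0) 0 (insub k).

(* The points of the [i]-th facet of the simplex of [c] are those whose [i]-th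
   coordinate vanishes, and they are identified with points of the simplex of
   [c'] by deleting this coordinate. *)
Definition glued (p q : simplices) : Prop :=
  exists i : nat,
    [/\ chain_face i (sval (projT1 p)) (sval (projT1 q)), coord p i = 0
      & forall k, coord p (bump i k) = coord q k].

Definition gluing_rel (p q : simplices) : bool :=
  `[< clos_refl_sym_trans simplices glued p q >].

Fact gluing_refl : reflexive gluing_rel.
Proof. by move=> p; apply/asboolP/rst_refl. Qed.

Fact gluing_sym : symmetric gluing_rel.
Proof. by move=> p q; apply/asboolP/asboolP; apply: rst_sym. Qed.

Fact gluing_trans : transitive gluing_rel.
Proof.
by move=> q p r /asboolP pq /asboolP qr; apply/asboolP; apply: rst_trans pq qr.
Qed.

Definition gluing := EquivRel gluing_rel gluing_refl gluing_sym gluing_trans.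

Definition realization : topologicalType := quotient_topology {eq_quot gluing}.

End Realization.

Arguments std_simplex R m : clear implicits.

Definition quotient_group (K : numFieldType) (I : zmodClosed K) : Type :=
  Quotient.quot I.

Section QuotientGroup.
Variables (K : numFieldType) (I : zmodClosed K).
Local Notation Q := (quotient_group I).
HB.instance Definition _ :=
  Topological.copy Q (quotient_topology (Quotient.quot I)).
HB.instance Definition _ := Quotient.on Q.
HB.instance Definition _ := GRing.Zmodule.on Q.

Lemma quotient_groupP (x y : K) :
  (\pi_Q x = \pi_Q y) <-> x - y \in I.
Proof.
by rewrite (Quotient.idealrBE I x y); split=> [e|/eqP//]; apply/eqP.
Qed.

End QuotientGroup.

Section Tori.
Variable R : realType.

Definition integers : {pred R} := [pred x | x \is a Num.int].

Fact integers_closed : zmod_closed integers.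
Proof. by split=> [|x y]; rewrite !inE; [exact: rpred0 | exact: rpredB]. Qed.

HB.instance Definition _ :=
  GRing.isZmodClosed.Build R integers integers_closed.

Definition lattice (omega : R[i]) : {pred R[i]} :=
  [pred z | `[< exists m n : int, z = m%:~R + n%:~R * omega >]].

Fact lattice_closed omega : zmod_closed (lattice omega).
Proof.
split=> [|x y /asboolP[m [n ->]] /asboolP[m' [n' ->]]]; apply/asboolP.
  by exists 0, 0; rewrite mul0r addr0.
by exists (m - m'), (n - n'); rewrite !intrB mulrBl opprD addrACA.
Qed.

HB.instance Definition _ omega :=
  GRing.isZmodClosed.Build R[i] (lattice omega) (lattice_closed omega).

Definition circle := quotient_group integers.
Definition elliptic_curve (omega : R[i]) := quotient_group (lattice omega).

(* The class of t + omega t for any representative t of the argument. *)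
Definition circle_diag (omega : R[i]) (t : circle) : elliptic_curve omega :=
  \pi_(elliptic_curve omega)
     ((repr t : R)%:C%C + omega * (repr t : R)%:C%C).

Lemma circle_diagE omega (t : R) :
  circle_diag omega (\pi_circle t) =
  \pi_(elliptic_curve omega) (t%:C%C + omega * t%:C%C).
Proof.
apply/quotient_groupP.
set s := repr _.
have /quotient_groupP : \pi_circle s = \pi_circle t by rewrite reprK.
case/intrP => m stm; apply/asboolP; exists m, m.
rewrite opprD addrACA -mulrBr -rmorphB /= stm mulrC; congr (_ + _ * _).
  by rewrite rmorph_int.
by rewrite rmorph_int.
Qed.

End Tori.

(* The homomorphism z |-> \sum_k a_k z_k on G^d defined by an integer vector. *)
Definition character (G : zmodType) (d : nat) (a : 'cV[int]_d) (z : 'rV[G]_d)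
  : G := \sum_k z 0 k *~ a k 0.

Section Arrangements.
Variables (R : realType) (d n : nat) (A : 'M[int]_(d, n)).
Variable b : 'I_n -> circle R.
Local Notation V := 'rV[R]_d.

Definition toric_hypersurface (j : 'I_n) : set 'rV[circle R]_d :=
  [set x | character (col j A) x = b j].

Definition toric_arrangement : set (set 'rV[circle R]_d) :=
  range toric_hypersurface.

Definition elliptic_hypersurface (omega : R[i]) (j : 'I_n) :
    set 'rV[elliptic_curve omega]_d :=
  [set z | character (col j A) z = circle_diag omega (b j)].
Arguments elliptic_hypersurface omega j : clear implicits.

Definition elliptic_complement (omega : R[i]) :
    set 'rV[elliptic_curve omega]_d :=
  ~` \bigcup_j elliptic_hypersurface omega j.

Definition toric_projection (x : V) : 'rV[circle R]_d :=
  map_mx \pi_(circle R) x.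

Definition lifted_arrangement : set (set V) :=
  [set L | exists H x, [/\ toric_arrangement H, (toric_projection @^-1` H) x
     & L = connected_component (toric_projection @^-1` H) x]].

(* The points lying on the same hyperplanes as [x], and in the same open
   half-space (component of the complement) for each of the others; [face_ofP]
   below describes them by the signs of the defining affine forms. *)
Definition face_of (x : V) : set V :=
  [set y | forall L, lifted_arrangement L ->
     (L x <-> L y) /\ connected_component (~` L) x = connected_component (~` L) y].

Definition faces : set (set V) := range face_of.

Definition translate (v : 'rV[int]_d) (P : set V) : set V :=
  [set x + map_mx intr v | x in P].

Definition face_orbit (P : set V) : set (set V) :=
  [set translate v P | v in setT].

Definition pair_orbit (P Q : set V) : set (set V * set V) :=
  [set (translate v P, translate v Q) | v in setT].

Definition cell := {F : set (set V) | exists2 P, faces P & F = face_orbit P}.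

Definition cell_morphism (F G : cell) :=
  {m : set (set V * set V) | exists P Q,
     [/\ sval F P, sval G Q, P `<=` closure Q & m = pair_orbit P Q]}.

(* The image in (S^1)^d of any face of the orbit. *)
Definition cell_set (F : cell) : set 'rV[circle R]_d :=
  [set toric_projection x | x in \bigcup_(P in sval F) P].

Definition supp (F : cell) : set (set 'rV[circle R]_d) :=
  [set H | toric_arrangement H /\ cell_set F `<=` H].

Local Notation ell j := (@character R d (col j A)).

Lemma characterD (G : zmodType) (a : 'cV[int]_d) (x y : 'rV[G]_d) :
  character a (x + y) = character a x + character a y.
Proof.
by rewrite -big_split; apply: eq_bigr => k _; rewrite mxE mulrzDl.
Qed.

Lemma characterN (G : zmodType) (a : 'cV[int]_d) (x : 'rV[G]_d) :
  character a (- x) = - character a x.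
Proof.
by rewrite -sumrN; apply: eq_bigr => k _; rewrite mxE mulNrz.
Qed.

Lemma character_scale (a : 'cV[int]_d) (t : R) (x : V) :
  character a (t *: x) = t * character a x.
Proof.
by rewrite mulr_sumr; apply: eq_bigr => k _; rewrite mxE mulrzAr.
Qed.

Lemma character_int (a : 'cV[int]_d) (v : 'rV[int]_d) :
  character a (map_mx intr v : V) = (character a v)%:~R.
Proof.
rewrite /character rmorph_sum; apply: eq_bigr => k _ /=.
by rewrite mxE -[LHS]mulrzr -intrM mulrzz.
Qed.

Lemma character_projection (a : 'cV[int]_d) (x : V) :
  character a (toric_projection x) = \pi_(circle R) (character a x).
Proof.
rewrite /character raddf_sum; apply: eq_bigr => k _.
by rewrite mxE raddfMz.
Qed.

Lemma character_continuous (a : 'cV[int]_d) :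
  continuous (@character R d a).
Proof.
rewrite /character; elim: (index_enum _) => [|k s IHs] x.
  rewrite (_ : (fun _ => _) = cst 0); first exact: cst_continuous.
  by apply/funext => z; rewrite big_nil.
rewrite (_ : (fun _ => _) = (fun z : V => z 0 k * (a k 0)%:~R) \+
    (fun z : V => \sum_(l <- s) z 0 l *~ a l 0)); last first.
  by apply/funext => z; rewrite big_cons -mulrzr.
apply: continuousD; last exact: IHs.
by apply: continuousM; [exact: coord_continuous | exact: cst_continuous].
Qed.

Lemma preimage_hypersurface j (x : V) :
  (toric_projection @^-1` toric_hypersurface j) x <->
  \pi_(circle R) (ell j x) = b j.
Proof. by rewrite /preimage /toric_hypersurface /= character_projection. Qed.

Lemma segment_component (S : set V) (x y : V) :
  (forall t, 0 <= t <= 1 -> S (x + t *: (y - x))) ->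
  connected_component S x y.
Proof.
move=> Sxy.
exists ((fun t : R => x + t *: (y - x)) @` `[0, 1]); last first.
  by exists 1; rewrite /= ?in_itv /= ?lexx ?ler01// scale1r addrC subrK.
split.
- by exists 0; rewrite /= ?in_itv /= ?lexx ?ler01// scale0r addr0.
- by move=> _ [t t01 <-]; apply: Sxy; move: t01; rewrite /= in_itv.
- apply: connected_continuous_connected; first exact: segment_connected.
  apply: continuous_subspaceT => t.
  apply: cvgD; first exact: cvg_cst.
  by apply: cvgZr_tmp; exact: cvg_id.
Qed.

Lemma half_itv : (0 : int)%:~R < (2^-1 : R) < (1 : int)%:~R.
Proof. by rewrite invr_gt0 ltr0n invf_lt1// ltr1n. Qed.

Lemma component_hypersurface j (x : V) :
  \pi_(circle R) (ell j x) = b j ->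
  connected_component (toric_projection @^-1` toric_hypersurface j) x =
  [set y | ell j y = ell j x].
Proof.
move=> bx; apply/seteqP; split=> [y [C [Cx CS Cc] Cy]|y /= xy]; last first.
  apply: segment_component => t _; apply/preimage_hypersurface.
  by rewrite characterD character_scale characterD characterN xy subrr mulr0 addr0.
have /connected_intervalP I : connected (ell j @` C).
  apply: connected_continuous_connected => //.
  exact/continuous_subspaceT/character_continuous.
have subrBB_shift (c a e : R) : (a - c) - (e - c) = a - e by ring.
have Z z : C z -> ell j z - ell j x \is a Num.int.
  move=> /CS /preimage_hypersurface bz.
  by have /quotient_groupP : \pi_(circle R) (ell j z) = \pi_(circle R) (ell j x)
    by rewrite bz bx.
have key u v : C u -> C v -> ell j u < ell j v -> False.
  move=> Cu Cv uv.
  have Zu : ell j v - ell j u \is a Num.int.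
    by rewrite -(subrBB_shift (ell j x)); apply: rpredB; exact: Z.
  case/intrP: Zu => m; rewrite -[LHS]opprB => mE.
  have m1 : (1 : R) <= m%:~R.
    rewrite -[1]/(1%:~R) ler_int -gtz0_ge1 -(ltr_int R) -mE opprB subr_gt0 //.
  have [|||w Cw wE] := I (ell j u) (ell j v) _ _ (ell j u + 2^-1).
  - by exists u.
  - by exists v.
  - apply/andP; split; first by rewrite lerDl invr_ge0.
    by rewrite -lerBrDl -opprB mE (le_trans _ m1)// invf_le1// ler1n.
  have : ell j w - ell j u \is a Num.int.
    by rewrite -(subrBB_shift (ell j x)); apply: rpredB; exact: Z.
  rewrite wE addrC addKr => /intrP[k kE].
  move: half_itv; rewrite kE !ltr_int => /andP[].
  by case: k {kE} => // -[].
rewrite /=; case: (ltgtP (ell j y) (ell j x)) => // xy; exfalso.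
- exact: (key y x).
- exact: (key x y).
Qed.

Lemma lifted_arrangementP (L : set V) : lifted_arrangement L <->
  exists j x, \pi_(circle R) (ell j x) = b j /\ L = [set y | ell j y = ell j x].
Proof.
split=> [[_ [x [[j _ <-] /preimage_hypersurface xj ->]]]|[j [x [xj ->]]]].
  by exists j, x; split => //; exact: component_hypersurface.
exists (toric_hypersurface j), x; split; first by exists j.
  exact/preimage_hypersurface.
by rewrite component_hypersurface.
Qed.

Lemma same_side j (beta : R) (x y : V) :
  ((ell j x = beta <-> ell j y = beta) /\
   connected_component (~` [set z | ell j z = beta]) x =
   connected_component (~` [set z | ell j z = beta]) y) <->
  Num.sg (ell j x - beta) = Num.sg (ell j y - beta).
Proof.
set L := [set z | _].
split=> [[Lxy Cxy]|sxy].
  have key u v : connected_component (~` L) u = connected_component (~` L) v ->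
      ell j u < beta -> beta < ell j v -> False.
    move=> Cuv ub bv.
    have Lu : (~` L) u by move=> /= ube; rewrite ube ltxx in ub.
    have Lv : (~` L) v by move=> /= vbe; rewrite vbe ltxx in bv.
    have uu : connected_component (~` L) u u by exact: connected_component_refl.
    have uv : connected_component (~` L) u v
      by rewrite Cuv; exact: connected_component_refl.
    have /connected_intervalP I :
        connected (ell j @` connected_component (~` L) u).
      apply: connected_continuous_connected; first exact: component_connected.
      exact/continuous_subspaceT/character_continuous.
    have [|||w Cw wE] := I (ell j u) (ell j v) _ _ beta.
    - by exists u.
    - by exists v.
    - by rewrite !ltW.
    exact: (connected_component_sub Cw).
  case: (ltgtP (ell j x) beta) => xb.
  - case: (ltgtP (ell j y) beta) => yb.
    + by rewrite !ltr0_sg ?subr_lt0.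
    + by case: (key x y).
    + by move: xb; rewrite (Lxy.2 yb) ltxx.
  - case: (ltgtP (ell j y) beta) => yb.
    + by case: (key y x).
    + by rewrite !gtr0_sg ?subr_gt0.
    + by move: xb; rewrite (Lxy.2 yb) ltxx.
  - by rewrite xb (Lxy.1 xb).
have E : ell j x = beta <-> ell j y = beta.
  split=> e; apply/eqP; rewrite -subr_eq0 -sgr_eq0.
    by rewrite -sxy e subrr sgr0.
  by rewrite sxy e subrr sgr0.
split=> //.
have [/= xb|/= xb] := pselect (L x).
  by rewrite !connected_component_out//= /L /= => h; apply: h => //; exact/E.
apply/same_connected_component/segment_component => t /andP[t0 t1] /= /eqP.
have xb' : ell j x - beta != 0 by rewrite subr_eq0; exact/eqP.
have -> : ell j (x + t *: (y - x)) = (1 - t) * ell j x + t * ell j y.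
  by rewrite characterD character_scale characterD characterN; ring.
rewrite -subr_eq0.
have -> : (1 - t) * ell j x + t * ell j y - beta =
          (1 - t) * (ell j x - beta) + t * (ell j y - beta).
  by ring.
rewrite (numEsg (ell j x - beta)) (numEsg (ell j y - beta)) -sxy.
rewrite mulrCA (mulrCA t) -mulrDr mulf_eq0 sgr_eq0 (negbTE xb') /=.
have yb' : ell j y - beta != 0 by rewrite -sgr_eq0 -sxy sgr_eq0.
apply/negP; rewrite paddr_eq0 ?mulr_ge0 ?subr_ge0//.
rewrite !mulf_eq0 !normr_eq0 (negbTE xb') (negbTE yb') !orbF.
apply/negP => /andP[]; by rewrite subr_eq0 => /eqP <-; rewrite oner_eq0.
Qed.

Lemma face_ofP (x y : V) : face_of x y <->
  forall j beta, \pi_(circle R) beta = b j ->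
    Num.sg (ell j x - beta) = Num.sg (ell j y - beta).
Proof.
split=> [xy j beta bE|xy L].
  have [a0|a0] := pselect (exists z, ell j z = beta).
    case: a0 => z zE; apply/same_side.
    apply: (xy [set w | ell j w = beta]); apply/lifted_arrangementP.
    by exists j, z; rewrite zE.
  suff aj : forall z, ell j z = 0 by rewrite !aj.
  move=> z; apply: contrapT => /eqP z0; apply: a0.
  by exists ((beta / ell j z) *: z); rewrite character_scale divfK.
by move=> /lifted_arrangementP[j [z [bE ->]]]; apply/same_side/xy.
Qed.

Lemma face_of_refl x : face_of x x.
Proof. exact/face_ofP. Qed.

Lemma face_of_eq x y : face_of x y -> face_of x = face_of y.
Proof.
move/face_ofP => xy; apply/seteqP.
by split=> z /face_ofP h; apply/face_ofP => j beta bE; rewrite -h// xy.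
Qed.

Lemma circle_shift (beta : R) (m : int) :
  \pi_(circle R) (beta + m%:~R) = \pi_(circle R) beta.
Proof.
by apply/quotient_groupP; rewrite addrC addKr; exact: intr_int.
Qed.

Lemma translate_face_of v x :
  translate v (face_of x) = face_of (x + map_mx intr v).
Proof.
have sub w u : translate w (face_of u) `<=` face_of (u + map_mx intr w).
  move=> _ [y /face_ofP uy <-]; apply/face_ofP => j beta bE.
  have E (c : R) (m : int) : c + m%:~R - beta = c - (beta + (- m)%:~R).
    by rewrite intrN; ring.
  by rewrite !characterD character_int !E; apply: uy; rewrite circle_shift.
apply/seteqP; split=> // y xy.
exists (y - map_mx intr v); last by rewrite subrK.
have /(_ (y - map_mx intr v)) := @sub (- v) (x + map_mx intr v).
rewrite map_mxN addrK; apply; exists y => //.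
by rewrite map_mxN.
Qed.

Lemma closure_face_of x y : closure (face_of x) y ->
  forall j beta, \pi_(circle R) beta = b j ->
    Num.sg (ell j y - beta) = 0 \/
    Num.sg (ell j y - beta) = Num.sg (ell j x - beta).
Proof.
move=> cy j beta bE.
have sub (T : set R) : closed T ->
    (forall z, face_of x z -> T (ell j z)) -> T (ell j y).
  move=> cT xT; have : closed (ell j @^-1` T).
    by apply: preimage_closed => // z _; exact: character_continuous.
  by move=> /closure_id cTE; rewrite -[T _]/((ell j @^-1` T) y) cTE; apply: closureS cy.
have sgE z : face_of x z -> Num.sg (ell j z - beta) = Num.sg (ell j x - beta).
  by move=> /face_ofP/(_ j beta bE).
have [xb|xb|xb] := ltgtP (ell j x) beta.
- have : ell j y <= beta.
    apply: (sub [set r | r <= beta]); first exact: closed_le.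
    move=> z /sgE; rewrite (ltr0_sg (_ : ell j x - beta < 0)) ?subr_lt0//.
    by move=> /eqP; rewrite sgr_cp0 subr_lt0 => /ltW.
  rewrite le_eqVlt => /predU1P[->|yb]; first by left; rewrite subrr sgr0.
  by right; rewrite !ltr0_sg ?subr_lt0.
- have : beta <= ell j y.
    apply: (sub [set r | beta <= r]); first exact: closed_ge.
    move=> z /sgE; rewrite (gtr0_sg (_ : 0 < ell j x - beta)) ?subr_gt0//.
    by move=> /eqP; rewrite sgr_cp0 subr_gt0 => /ltW.
  rewrite le_eqVlt => /predU1P[<-|yb]; first by left; rewrite subrr sgr0.
  by right; rewrite !gtr0_sg ?subr_gt0.
- left; suff -> : ell j y = beta by rewrite subrr sgr0.
  apply: (sub [set r | r = beta]); first exact: closed_eq.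
  move=> z /sgE; rewrite xb subrr sgr0 => /eqP.
  by rewrite sgr_eq0 subr_eq0 => /eqP.
Qed.

Lemma closure_same_face x y :
  face_of x `<=` closure (face_of y) -> face_of y `<=` closure (face_of x) ->
  face_of x = face_of y.
Proof.
move=> xy yx; apply/face_of_eq/face_ofP => j beta bE.
have [|//] := closure_face_of (xy _ (face_of_refl x)) bE.
by have [->|//] := closure_face_of (yx _ (face_of_refl y)) bE => ->.
Qed.

Lemma translateE v (P : set V) x : translate v P x <-> P (x - map_mx intr v).
Proof.
split=> [[y Py <-]|Px]; first by rewrite addrK.
by exists (x - map_mx intr v); rewrite ?subrK.
Qed.

Lemma translate0 (P : set V) : translate 0 P = P.
Proof.
by apply/seteqP; split=> x /=; rewrite translateE map_mx0 subr0.
Qed.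

Lemma translateD v w (P : set V) :
  translate v (translate w P) = translate (v + w) P.
Proof.
by apply/seteqP; split=> x /=; rewrite !translateE map_mxD opprD addrA.
Qed.

Lemma translate_closure v (P Q : set V) :
  P `<=` closure Q -> translate v P `<=` closure (translate v Q).
Proof.
move=> PQ _ [x Px <-] B Bx.
have c : {for x, continuous (fun y : V => y + map_mx intr v)}.
  by apply: (@continuousD R V V id); [exact: cvg_id | exact: cst_continuous].
have [y [Qy By]] := PQ _ Px _ (c _ Bx).
exists (y + map_mx intr v); split; first by exists y.
exact: By.
Qed.

Lemma subset_closure_trans (P Q S : set V) :
  P `<=` closure Q -> Q `<=` closure S -> P `<=` closure S.
Proof.
move=> PQ /closureS QS x /PQ /QS.
by rewrite -(closure_id _).1//; exact: closed_closure.
Qed.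

Lemma face_translate v P : faces P -> faces (translate v P).
Proof.
move=> [x _ <-]; rewrite translate_face_of.
by exists (x + map_mx intr v).
Qed.

Lemma cell_face (F : cell) P : sval F P -> faces P.
Proof.
case: F => _ /= [P0 fP0 ->] [v _ <-]; exact: face_translate.
Qed.

Lemma cell_translate (F : cell) P v : sval F P -> sval F (translate v P).
Proof.
case: F => _ /= [P0 fP0 ->] [w _ <-].
by exists (v + w) => //; rewrite translateD.
Qed.

Lemma cell_orbit (F : cell) P : sval F P -> sval F = face_orbit P.
Proof.
case: F => _ /= [P0 fP0 ->] [v _ <-]; apply/seteqP; split=> Q [w _ <-].
  by exists (w - v) => //; rewrite translateD subrK.
by exists (w + v) => //; rewrite translateD.
Qed.

Lemma cell_eq (F G : cell) P : sval F P -> sval G P -> F = G.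
Proof.
move=> /cell_orbit FP /cell_orbit; rewrite -FP => GF.
by case: F G {FP} GF => [F fF] [G fG] /= GF; apply: eq_exist.
Qed.

Section FaceCategory.
Hypothesis A_rank : \rank (map_mx (intr : int -> rat) A) = d.

Lemma translate_free v P : faces P -> P `<=` closure (translate v P) -> v = 0.
Proof.
move=> [x _ <-]; rewrite translate_face_of => /(_ _ (face_of_refl x)) cx.
have aj0 j : character (col j A) v = 0.
  have bE (k : int) : \pi_(circle R) (repr (b j) + k%:~R) = b j.
    by rewrite circle_shift reprK.
  set c : R := repr (b j) in bE *.
  have s (k : int) := closure_face_of cx (bE k).
  have {}s k : Num.sg (ell j x - (c + k%:~R)) = 0 \/
      Num.sg (ell j x - (c + k%:~R)) =
      Num.sg (ell j x + (character (col j A) v)%:~R - (c + k%:~R)).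
    by have := s k; rewrite characterD character_int.
  move: s; set m := character _ v; set r := ell j x => s.
  apply/eqP; case: (ltgtP m 0) => // m0.
  - have m1 : m%:~R <= -1 :> R.
      by rewrite -[-1]/((-1)%:~R) ler_int; case: m m0 {s} => // -[].
    pose k := Num.ceil (r - c) - 1.
    have k1 : c + k%:~R < r.
      rewrite /k intrB; have := ceilB1_lt (r - c); rewrite intrB; lra.
    have k2 : r <= c + k%:~R + 1.
      rewrite /k intrB; have := ceil_ge (r - c); lra.
    have := s k; rewrite gtr0_sg ?subr_gt0// => -[/eqP|/esym/eqP].
      by rewrite oner_eq0.
    by rewrite sgr_cp0 subr_gt0; lra.
  - have m1 : 1 <= m%:~R :> R.
      by rewrite -[1]/(1%:~R) ler_int; case: m m0 {s} => // -[].
    pose k := Num.floor (r - c) + 1.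
    have k1 : r < c + k%:~R.
      rewrite /k; have := floorD1_gt (r - c); lra.
    have k2 : c + k%:~R - 1 <= r.
      rewrite /k intrD; have := floor_le (r - c); lra.
    have := s k; rewrite ltr0_sg ?subr_lt0// => -[/eqP|/esym/eqP].
      by rewrite oppr_eq0 oner_eq0.
    by rewrite sgr_cp0 subr_lt0; lra.
have fA : row_free (map_mx (intr : int -> rat) A) by rewrite /row_free A_rank.
have : map_mx (intr : int -> rat) v = 0.
  apply: (row_free_inj fA); rewrite mul0mx -map_mxM.
  apply/matrixP => i j; rewrite !mxE ord1.
  rewrite (_ : \sum_k (v 0 k * A k j) = character (col j A) v); first by rewrite aj0.
  by rewrite /character; apply: eq_bigr => k _; rewrite !mxE mulrzz.
move=> /matrixP v0; apply/matrixP => i j.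
by have := v0 i j; rewrite !mxE => /eqP; rewrite intr_eq0 => /eqP.
Qed.

Lemma translate_inj v w P : faces P -> translate v P = translate w P -> v = w.
Proof.
move=> fP vw; apply/eqP; rewrite -subr_eq0; apply/eqP.
apply: (@translate_free _ P) => //.
have -> : translate (v - w) P = P.
  by rewrite addrC -translateD vw translateD addNr translate0.
exact: subset_closure.
Qed.

Fact cell_id_subproof (F : cell) : exists P Q,
  [/\ sval F P, sval F Q, P `<=` closure Q
    & [set PQ | sval F PQ.1 /\ PQ.1 = PQ.2] = pair_orbit P Q].
Proof.
case: (svalP F) => P fP FE; exists P, P.
have FP : sval F P by rewrite FE; exists 0 => //; rewrite translate0.
split=> //; first exact: subset_closure.
apply/seteqP; split=> [[Q Q']|] /=.
  by rewrite FE => -[[v _ <-] <-]; exists v.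
by move=> _ [v _ <-] /=; split => //; exact: cell_translate.
Qed.

Definition cell_id (F : cell) : cell_morphism F F :=
  exist _ _ (cell_id_subproof F).

Fact cell_comp_subproof (F G H : cell)
  (m1 : cell_morphism F G) (m2 : cell_morphism G H) : exists P Q,
  [/\ sval F P, sval H Q, P `<=` closure Q
    & (sval m2 \; sval m1)%relation = pair_orbit P Q].
Proof.
case: m1 m2 => _ /= [P [Q [FP GQ PQ ->]]] [_ /= [Q' [S [GQ' HS QS ->]]]].
move: (GQ'); rewrite (cell_orbit GQ) => -[w _ wE].
exists P, (translate (- w) S); split => //; first exact: cell_translate.
  have QS' : Q `<=` closure (translate (- w) S).
    have := translate_closure (v := - w) QS.
    by rewrite -wE translateD addNr translate0.
  exact: subset_closure_trans QS'.
apply/seteqP; split=> [[X Z] [Y [v _ [<- <-]] [u _ [uE <-]]]|] /=.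
  exists v => //; congr (_, _); rewrite translateD; congr translate.
  have /(translate_inj (cell_face GQ)) -> : translate v Q = translate (u + w) Q.
    by rewrite -uE -wE translateD.
  by rewrite addrK.
move=> _ [v _ <-] /=; exists (translate v Q); first by exists v.
by exists (v - w) => //; rewrite -wE !translateD subrK.
Qed.

(* The composite of the orbits of (P, Q) and (Q, S) is the orbit of (P, S);
   as a set of pairs it is the relational composite (written from right to
   left) of the two orbits. *)
Definition cell_comp (F G H : cell)
    (m1 : cell_morphism F G) (m2 : cell_morphism G H) : cell_morphism F H :=
  exist _ _ (cell_comp_subproof m1 m2).

Lemma cell_compE (F G H : cell)
    (m1 : cell_morphism F G) (m2 : cell_morphism G H) (P Q S : set V) :
  sval m1 = pair_orbit P Q -> sval m2 = pair_orbit Q S ->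
  sval (cell_comp m1 m2) = pair_orbit P S.
Proof.
have orbit_id X Y : pair_orbit X Y (X, Y).
  by exists 0 => //; rewrite !translate0.
move=> e1 e2; case: (svalP (cell_comp m1 m2)) => P' [S' [_ _ _ e]].
have : sval (cell_comp m1 m2) (P, S).
  by exists Q; rewrite /= ?e1 ?e2; exact: orbit_id.
rewrite e => -[v _ [<- <-]]; apply/seteqP; split=> _ [w _ <-].
  by exists (w - v) => //; rewrite !translateD subrK.
by exists (w + v) => //; rewrite !translateD.
Qed.

Lemma cell_morphism_mem (F G : cell) (m : cell_morphism F G) P Q :
  sval m (P, Q) -> sval F P /\ sval G Q.
Proof.
case: m => _ /= [P' [Q' [FP GQ _ ->]]] [v _ [<- <-]].
by split; exact: cell_translate.
Qed.

Lemma cell_morphism_eq (F G : cell) (m1 m2 : cell_morphism F G) :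
  sval m1 = sval m2 -> m1 = m2.
Proof. by case: m1 m2 => [m1 h1] [m2 h2] /= e; apply: eq_exist. Qed.

Fact cell_comp1m (F G : cell) (m : cell_morphism F G) :
  cell_comp (cell_id F) m = m.
Proof.
apply/cell_morphism_eq/seteqP; split=> -[P Q] /=.
  by move=> [P' /= [_ ->]].
by move=> mPQ; exists P => //=; case: (cell_morphism_mem mPQ).
Qed.

Fact cell_compm1 (F G : cell) (m : cell_morphism F G) :
  cell_comp m (cell_id G) = m.
Proof.
apply/cell_morphism_eq/seteqP; split=> -[P Q] /=.
  by move=> [Q' /= + [_ <-]].
by move=> mPQ; exists Q => //=; case: (cell_morphism_mem mPQ).
Qed.

Fact cell_compA (F G H K : cell) (m1 : cell_morphism F G)
    (m2 : cell_morphism G H) (m3 : cell_morphism H K) :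
  cell_comp m1 (cell_comp m2 m3) = cell_comp (cell_comp m1 m2) m3.
Proof.
apply/cell_morphism_eq/seteqP; split=> -[P S] /=.
  by move=> [Q /= h1 [T /= h2 h3]]; exists T => //; exists Q.
by move=> [T /= [Q /= h1 h2] h3]; exists Q => //; exists T.
Qed.

Definition face_category : category :=
  Category cell_comp1m cell_compm1 cell_compA.

Lemma face_category_acyclic : acyclic face_category.
Proof.
split=> [F G f g _ _|F f].
  case: f g => _ /= [P [Q [FP GQ PQ _]]] [_ /= [Q' [S [GQ' FS QS _]]]].
  move: (GQ'); rewrite (cell_orbit GQ) => -[w _ wE].
  have QS' : Q `<=` closure (translate (- w) S).
    have := translate_closure (v := - w) QS.
    by rewrite -wE translateD addNr translate0.
  have : sval F (translate (- w) S) by exact: cell_translate.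
  rewrite (cell_orbit FP) => -[u _ uE]; rewrite -uE in QS'.
  have clP : P `<=` closure (translate u P).
    exact: subset_closure_trans QS'.
  have u0 := translate_free (cell_face FP) clP.
  rewrite u0 translate0 in QS'.
  have E : P = Q.
    case: (cell_face FP) (cell_face GQ) PQ QS' => x _ <- [y _ <-].
    exact: closure_same_face.
  by apply: (cell_eq FP); rewrite E.
apply: cell_morphism_eq.
case: f => _ /= [P [Q [FP FQ PQ ->]]].
move: (FQ); rewrite (cell_orbit FP) => -[v _ vE].
rewrite -vE in PQ.
have v0 := translate_free (cell_face FP) PQ.
rewrite -vE v0 translate0; apply/seteqP; split.
  by move=> _ [w _ <-] /=; split=> //; exists w.
by move=> [X Y] /= [[w _ <-] <-]; exists w.
Qed.

Definition cell_pair_category : category :=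
  @full_subcategory
    (product_category (opposite face_category) (opposite face_category))
    (fun FG : cell * cell => supp FG.1 `&` supp FG.2 = set0).

Lemma cell_pair_category_acyclic : acyclic cell_pair_category.
Proof.
apply/acyclic_full/acyclic_product; apply: acyclic_opposite;
  exact: face_category_acyclic.
Qed.

End FaceCategory.

End Arrangements.

Arguments elliptic_hypersurface {R d n} A b omega j.
Arguments elliptic_complement {R d n} A b omega.

(* Main.v *)
Require Import Defs.
From HB Require Import structures.
From mathcomp Require Import all_boot all_order all_algebra.
From mathcomp Require Import all_classical all_reals topology normedtype.
From mathcomp Require Import complex zify ring lra.
From Stdlib Require Import Relation_Operators.

Set Implicit Arguments.
Unset Strict Implicit.
Unset Printing Implicit Defensive.

Import Order.TTheory GRing.Theory Num.Theory.
Import numFieldNormedType.Exports.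

Local Open Scope classical_set_scope.
Local Open Scope ring_scope.

(** Writing z = x + omega y identifies E^d with the product T x T of two copies
    of the torus T = (S^1)^d, and the complement with the set of pairs (x, y)
    such that no H_j contains both x and y.  Its preimage U in the product R^d x
    R^d of the universal covers is a union of faces of the product arrangement,
    and every face whose closure meets U is contained in U.  Choose a center in
    each face, equivariantly under the lattice Z^d x Z^d.  Decreasing sequences
    of faces span the simplices of a barycentric subdivision of R^d x R^d, so
    that each point has barycentric coordinates carried by such a sequence.
    Dropping the coordinates of the centers outside U and normalizing the others
    retracts U onto the union of the simplices with vertices in U, and a point
    moves to its image within its own face; modulo the lattice, this union is
    the realization of the category of pairs of cells with disjoint supports. *)

(** * Lattice-periodic arrangements *)

Lemma floor_le_ceil (R : realType) (t : R) : Num.floor t <= Num.ceil t.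
Proof. by rewrite -(ler_int R) (le_trans (floor_le _)) ?ceil_ge. Qed.

Fact center_key : unit.
Proof. exact: tt. Qed.

Section LatticeArrangement.
Variables (R : realType) (N p : nat) (B : 'M[int]_(N, p)) (beta : 'rV[R]_p).
Hypothesis B_free : row_free (map_mx intr B : 'M[R]_(N, p)).
Local Notation W := 'rV[R]_N.
Local Notation "''i' v" := (map_mx intr v : W) (at level 10, v at level 9).

Definition pos (z : W) (j : 'I_p) : R := (z *m map_mx intr B) 0 j - beta 0 j.

Definition face_le (y z : W) : bool :=
  [forall j, (Num.floor (pos z j) <= Num.floor (pos y j)) &&
             (Num.ceil (pos y j) <= Num.ceil (pos z j))].
Definition face_lt (y z : W) : bool := face_le y z && ~~ face_le z y.
Definition same_face (y z : W) : bool := face_le y z && face_le z y.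
Local Notation above := (fun y z => face_lt z y).

Lemma face_leP y z : reflect (forall j,
    (Num.floor (pos z j))%:~R <= pos y j <= (Num.ceil (pos z j))%:~R)
  (face_le y z).
Proof.
by apply: (iffP forallP) => yz j; have := yz j; rewrite floor_ge_int ceil_le_int.
Qed.

Lemma face_le_refl : reflexive face_le.
Proof. by move=> y; apply/forallP => j; rewrite !lexx. Qed.

Lemma face_le_trans : transitive face_le.
Proof.
move=> y x z /forallP xy /forallP yz; apply/forallP => j.
case/andP: (xy j) => a b; case/andP: (yz j) => c d.
by rewrite (le_trans c a) (le_trans b d).
Qed.

Lemma face_lt_le y z : face_lt y z -> face_le y z.
Proof. by case/andP. Qed.

Lemma face_le_lt_trans x y z : face_le x y -> face_lt y z -> face_lt x z.
Proof.
move=> xy /andP[yz nzy]; rewrite /face_lt (face_le_trans xy yz).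
by apply: contra nzy => zx; exact: face_le_trans zx xy.
Qed.

Lemma face_lt_trans : transitive face_lt.
Proof. by move=> y x z /face_lt_le; exact: face_le_lt_trans. Qed.

Lemma above_trans : transitive above.
Proof. by move=> y x z xy yz; exact: face_lt_trans yz xy. Qed.

Lemma above_irr : irreflexive above.
Proof. by move=> z; rewrite /face_lt face_le_refl. Qed.

Lemma same_faceP y z : reflect (forall j,
    Num.floor (pos y j) = Num.floor (pos z j) /\
    Num.ceil (pos y j) = Num.ceil (pos z j))
  (same_face y z).
Proof.
apply: (iffP andP) => [[/forallP yz /forallP zy] j|yz].
  case/andP: (yz j) => a b; case/andP: (zy j) => c d.
  by split; apply/le_anti; apply/andP.
by split; apply/forallP => j; have [-> ->] := yz j; rewrite !lexx.
Qed.

Lemma same_face_sym y z : same_face y z = same_face z y.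
Proof. exact: andbC. Qed.

Lemma same_face_refl y : same_face y y.
Proof. by rewrite /same_face face_le_refl. Qed.

Lemma same_face_trans : transitive same_face.
Proof.
by move=> y x z /andP[xy yx] /andP[yz zy];
  rewrite /same_face (face_le_trans xy yz) (face_le_trans zy yx).
Qed.

Lemma wsum_gt0 (z0 : W) (zs : seq W) (w g : W -> R) :
  (forall y, y \in z0 :: zs -> 0 <= w y) ->
  (forall y, y \in z0 :: zs -> 0 <= g y) -> 0 < w z0 -> 0 < g z0 ->
  0 < \sum_(y <- z0 :: zs) w y * g y.
Proof.
move=> w0 g0 wz0 gz0; rewrite big_cons ltr_wpDr// ?mulr_gt0//.
by rewrite big_seq sumr_ge0// => y ys; rewrite mulr_ge0 ?w0 ?g0 ?inE ?ys ?orbT.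
Qed.

Lemma pos_sum (s : seq W) (w : W -> R) j :
  let c := \sum_(y <- s) w y in c != 0 ->
  pos (c^-1 *: \sum_(y <- s) w y *: y) j = c^-1 * \sum_(y <- s) w y * pos y j.
Proof.
move=> c c0; rewrite /pos -scalemxAl mxE.
under [in RHS]eq_bigr => y _ do rewrite mulrBr.
rewrite sumrB -mulr_suml mulrBr mulrA mulVf// mul1r; congr (_ * _ - _).
rewrite mulmx_suml summxE; apply: eq_bigr => y _.
by rewrite -scalemxAl mxE.
Qed.

Lemma pos_sumB (s : seq W) (w : W -> R) j (a : R) :
  let c := \sum_(y <- s) w y in c != 0 ->
  pos (c^-1 *: \sum_(y <- s) w y *: y) j - a =
  c^-1 * \sum_(y <- s) w y * (pos y j - a).
Proof.
move=> c c0; rewrite pos_sum//.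
under [in RHS]eq_bigr => y _ do rewrite mulrBr.
by rewrite sumrB -mulr_suml mulrBr [c^-1 * (_ * a)]mulrA mulVf// mul1r.
Qed.

Lemma pos_Bsum (s : seq W) (w : W -> R) j (a : R) :
  let c := \sum_(y <- s) w y in c != 0 ->
  a - pos (c^-1 *: \sum_(y <- s) w y *: y) j =
  c^-1 * \sum_(y <- s) w y * (a - pos y j).
Proof.
move=> c c0; rewrite -opprB pos_sumB// -mulrN -sumrN; congr (_ * _).
by apply: eq_bigr => y _; ring.
Qed.

Lemma same_face_comb (z0 : W) (zs : seq W) (w : W -> R) :
  (forall y, y \in zs -> face_le y z0) ->
  (forall y, y \in z0 :: zs -> 0 <= w y) -> 0 < w z0 ->
  same_face ((\sum_(y <- z0 :: zs) w y)^-1 *: \sum_(y <- z0 :: zs) w y *: y) z0.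
Proof.
move=> le0 w0 wz0; set c := \sum_(y <- z0 :: zs) w y.
have c0 : 0 < c.
  by rewrite /c big_cons ltr_wpDr// big_seq sumr_ge0// => y ys;
    rewrite w0 ?inE ?ys ?orbT.
have le y : y \in z0 :: zs -> face_le y z0.
  by rewrite inE => /predU1P[->|/le0//]; exact: face_le_refl.
apply/same_faceP => j; set X := _ *: _.
set a := Num.floor (pos z0 j); set b := Num.ceil (pos z0 j).
have bnd y : y \in z0 :: zs -> a%:~R <= pos y j <= b%:~R.
  by move=> /le /face_leP /(_ j).
have az : (a%:~R <= pos z0 j < (a + 1)%:~R) by exact: floor_itv.
have bz : ((b - 1)%:~R < pos z0 j <= b%:~R) by exact: ceil_itv.
have b1 : (b%:~R : R) <= (a + 1)%:~R.
  by rewrite ler_int ceil_le_int; case/andP: az => _ /ltW.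
have sg0 (g : W -> R) : (forall y, y \in z0 :: zs -> 0 <= g y) ->
    0 <= c^-1 * \sum_(y <- z0 :: zs) w y * g y.
  move=> g0; rewrite mulr_ge0 ?invr_ge0 ?(ltW c0)// big_seq sumr_ge0// => y ys.
  by rewrite mulr_ge0 ?w0 ?g0.
have sgt (g : W -> R) : (forall y, y \in z0 :: zs -> 0 <= g y) -> 0 < g z0 ->
    0 < c^-1 * \sum_(y <- z0 :: zs) w y * g y.
  by move=> g0 gz; rewrite mulr_gt0 ?invr_gt0// wsum_gt0.
have Xa : a%:~R <= pos X j.
  rewrite -subr_ge0 pos_sumB ?gt_eqF//; apply: sg0 => y /bnd; lra.
have Xb : pos X j <= b%:~R.
  rewrite -subr_ge0 pos_Bsum ?gt_eqF//.
  by apply: sg0 => y /bnd; lra.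
have Xa1 : pos X j < (a + 1)%:~R.
  rewrite -subr_gt0 pos_Bsum ?gt_eqF//.
  apply: sgt => [y /bnd|]; first by move: b1; lra.
  by move: az; lra.
have Xb1 : (b - 1)%:~R < pos X j.
  rewrite -subr_gt0 pos_sumB ?gt_eqF//; apply: sgt => [y /bnd|].
    by move: b1; rewrite intrD intrB; lra.
  by move: bz; lra.
by split; apply/eqP; rewrite ?floor_eq ?ceil_eq; apply/andP.
Qed.

Lemma pos_translate z (v : 'rV[int]_N) j :
  pos (z + 'i v) j = pos z j + ((v *m B) 0 j)%:~R.
Proof.
by rewrite /pos mulmxDl -map_mxM !mxE addrAC.
Qed.

Lemma floor_translate z v j :
  Num.floor (pos (z + 'i v) j) = Num.floor (pos z j) + (v *m B) 0 j.
Proof. by rewrite pos_translate floorDrz ?intr_int// intrKfloor. Qed.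

Lemma ceil_translate z v j :
  Num.ceil (pos (z + 'i v) j) = Num.ceil (pos z j) + (v *m B) 0 j.
Proof. by rewrite pos_translate ceilDrz ?intr_int// intrKceil. Qed.

Lemma face_le_translate y z v : face_le (y + 'i v) (z + 'i v) = face_le y z.
Proof.
by apply: eq_forallb => j; rewrite !floor_translate !ceil_translate !lerD2r.
Qed.

Lemma same_face_translate y z v :
  same_face (y + 'i v) (z + 'i v) = same_face y z.
Proof. by rewrite /same_face !face_le_translate. Qed.

Lemma same_face_translate_inj z v w :
  same_face (z + 'i v) (z + 'i w) -> v = w.
Proof.
move=> /same_faceP vw; apply/eqP; rewrite -subr_eq0.
have : 'i (v - w) = 0.
  apply: (row_free_inj B_free); rewrite mul0mx -map_mxM; apply/rowP => j.
  rewrite mulmxBl !mxE; have [/eqP] := vw j.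
  rewrite !floor_translate (inj_eq (addrI _)) => /eqP vwj _.
  by apply/eqP; rewrite intr_eq0 subr_eq0; move: vwj; rewrite !mxE => ->.
move=> /rowP e; apply/eqP/rowP => j; have := e j; rewrite !mxE.
by move=> /eqP; rewrite intr_eq0 => /eqP.
Qed.

Section Center.
Let rep (z : W) : W := xget 0 [set y | exists v, same_face y (z + 'i v)].
Let shift (z : W) : 'rV[int]_N := xget 0 [set v | same_face (rep z) (z + 'i v)].

(* An equivariant choice of a point in each face. *)
Definition center : W -> W :=
  locked_with center_key (fun z => rep z - 'i (shift z)).

Let centerE z : center z = rep z - 'i (shift z).
Proof. by rewrite /center unlock. Qed.

Let repP z : same_face (rep z) (z + 'i (shift z)).
Proof.
rewrite /shift; have [v vP] : exists v, same_face (rep z) (z + 'i v).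
  rewrite /rep; apply: (@xgetPex _ _ [set y | exists v, same_face y (z + 'i v)]).
  by exists z, 0; rewrite map_mx0 addr0 same_face_refl.
by apply: (@xgetPex _ _ [set v | same_face (rep z) (z + 'i v)]); exists v.
Qed.

Lemma same_face_center z : same_face (center z) z.
Proof.
rewrite -(same_face_translate _ _ (shift z)) centerE subrK; exact: repP.
Qed.

Lemma center_translate_eq y z v : same_face y (z + 'i v) ->
  center y = center z + 'i v.
Proof.
move=> yz.
have yzw w : same_face (y + 'i w) (z + 'i (v + w)).
  by rewrite map_mxD addrA same_face_translate.
have rE : rep y = rep z.
  congr xget; apply/seteqP; split=> x /= [w xw].
    by exists (v + w); apply: same_face_trans xw _.
  exists (w - v); apply: same_face_trans xw _; rewrite same_face_sym.
  by have := yzw (w - v); rewrite (addrC v) subrK.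
have sE : shift z = v + shift y.
  apply: (@same_face_translate_inj z).
  apply: (same_face_trans _ (yzw _)); apply: same_face_trans (repP y).
  by rewrite same_face_sym rE; exact: repP.
by rewrite !centerE rE sE map_mxD opprD addrA addrAC subrK.
Qed.

End Center.

Lemma center_translate z v : center (z + 'i v) = center z + 'i v.
Proof. by apply: center_translate_eq; exact: same_face_refl. Qed.

Lemma center_eq y z : same_face y z -> center y = center z.
Proof.
move=> yz; rewrite -[RHS]addr0 -[0](map_mx0 intr) -center_translate.
by apply: esym; rewrite map_mx0 addr0; apply: esym; rewrite
  (@center_translate_eq y z 0) ?map_mx0 ?addr0.
Qed.

Lemma centerK z : center (center z) = center z.
Proof. exact/center_eq/same_face_center. Qed.

Definition flag (s : seq W) : bool :=
  sorted above s && all (fun z => center z == z) s.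

Lemma flag_uniq s : flag s -> uniq s.
Proof. by case/andP => /(sorted_uniq above_trans above_irr). Qed.

Lemma flag_le z s y : flag (z :: s) -> y \in s -> face_lt y z.
Proof.
by case/andP => /= /(order_path_min above_trans) /allP zs _ /zs.
Qed.

Lemma flag_behead z s : flag (z :: s) -> flag s.
Proof. by case/andP => /path_sorted ? /andP[_ ?]; apply/andP. Qed.

Lemma flag_filter (P : pred W) s : flag s -> flag [seq y <- s | P y].
Proof.
move=> /andP[so al]; rewrite /flag sorted_filter//=; last exact: above_trans.
by apply/allP => z; rewrite mem_filter => /andP[_]; exact: (allP al).
Qed.

Lemma flag_head_eq z s z' s' (w w' : W -> R) :
  flag (z :: s) -> flag (z' :: s') ->
  {in z :: s, forall y, 0 < w y} -> {in z' :: s', forall y, 0 < w' y} ->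
  \sum_(y <- z :: s) w y = \sum_(y <- z' :: s') w' y ->
  \sum_(y <- z :: s) w y *: y = \sum_(y <- z' :: s') w' y *: y ->
  z = z'.
Proof.
move=> F F' w0 w0' cE XE.
have sf u t (f : W -> R) : flag (u :: t) -> {in u :: t, forall y, 0 < f y} ->
  same_face ((\sum_(y <- u :: t) f y)^-1 *: \sum_(y <- u :: t) f y *: y) u.
  move=> G f0; apply: same_face_comb => [y yt|y /f0/ltW//|].
    exact/face_lt_le/(flag_le G).
  by apply: f0; rewrite mem_head.
have ez u t : flag (u :: t) -> center u = u.
  by case/andP => _ /andP[/eqP].
rewrite -(ez _ _ F) -(ez _ _ F'); apply: center_eq.
apply: same_face_trans (sf _ _ _ F' w0'); rewrite same_face_sym -cE -XE.
exact: sf.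
Qed.

Lemma flag_coord_head_le z s s' (w w' : W -> R) :
  flag (z :: s) -> flag (z :: s') ->
  {in z :: s, forall y, 0 < w y} -> {in z :: s', forall y, 0 < w' y} ->
  \sum_(y <- z :: s) w y = \sum_(y <- z :: s') w' y ->
  \sum_(y <- z :: s) w y *: y = \sum_(y <- z :: s') w' y *: y ->
  w' z <= w z.
Proof.
move=> F F' w0 w0'; rewrite !big_cons => cE XE; rewrite leNgt; apply/negP => ww.
pose w'' y := if y == z then w' z - w z else w' y.
have zs' : z \notin s' by have /flag_uniq/andP[] := F'.
have w''E y : y \in s' -> w'' y = w' y.
  by rewrite /w''; case: eqP => // ->; rewrite (negbTE zs').
have w0'' : {in z :: s', forall y, 0 < w'' y}.
  move=> y; rewrite inE /w''; case: eqP => [_ _|_ /= ys]; first by rewrite subr_gt0.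
  by apply: w0'; rewrite inE ys orbT.
have cE' : \sum_(y <- s) w y = \sum_(y <- z :: s') w'' y.
  rewrite big_cons {1}/w'' eqxx addrAC -[LHS](addKr (w z)) addrC cE.
  by congr (_ + (_ + _)); apply: eq_big_seq => y ys; rewrite w''E.
have XE' : \sum_(y <- s) w y *: y = \sum_(y <- z :: s') w'' y *: y.
  rewrite big_cons {1}/w'' eqxx scalerBl addrAC -[LHS](addKr (w z *: z)) addrC XE.
  by congr (_ + (_ + _)); apply: eq_big_seq => y ys; rewrite w''E.
case: s F w0 cE' XE' {cE XE} => [|y s] F w0 cE' XE'.
  have : 0 < \sum_(y <- z :: s') w'' y.
    rewrite big_cons ltr_pwDl//; first by apply: w0''; rewrite mem_head.
    by rewrite big_seq sumr_ge0// => y ys; rewrite ltW ?w0''// inE ys orbT.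
  by rewrite -cE' big_nil ltxx.
have yz : y = z.
  apply: (flag_head_eq (flag_behead F) F' _ w0'' cE' XE').
  by move=> x xs; apply: w0; rewrite inE xs orbT.
by have := flag_le F (mem_head y s); rewrite yz above_irr.
Qed.

Lemma flag_coord_uniq s s' (w w' : W -> R) : flag s -> flag s' ->
  {in s, forall y, 0 < w y} -> {in s', forall y, 0 < w' y} ->
  \sum_(y <- s) w y = \sum_(y <- s') w' y ->
  \sum_(y <- s) w y *: y = \sum_(y <- s') w' y *: y ->
  s = s' /\ {in s, w =1 w'}.
Proof.
have sum0 z t (f : W -> R) : {in z :: t, forall y, 0 < f y} ->
    \sum_(y <- z :: t) f y != 0.
  move=> f0; rewrite gt_eqF// big_cons ltr_pwDl ?f0 ?mem_head//.
  by rewrite big_seq sumr_ge0// => y ys; rewrite ltW ?f0// inE ys orbT.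
elim: s s' => [|z s IHs] [|z' s'] F F' w0 w0' cE XE //.
- by move: (sum0 _ _ _ w0'); rewrite -cE big_nil eqxx.
- by move: (sum0 _ _ _ w0); rewrite cE big_nil eqxx.
have zz := flag_head_eq F F' w0 w0' cE XE; rewrite -{}zz in F' w0' cE XE *.
have wz : w z = w' z.
  apply/le_anti/andP; split.
    exact: (flag_coord_head_le F' F w0' w0 (esym cE) (esym XE)).
  exact: (flag_coord_head_le F F' w0 w0' cE XE).
have [||||] := IHs s' (flag_behead F) (flag_behead F').
- by move=> y ys; apply: w0; rewrite inE ys orbT.
- by move=> y ys; apply: w0'; rewrite inE ys orbT.
- by move: cE; rewrite !big_cons wz => /addrI.
- by move: XE; rewrite !big_cons wz => /addrI.
move=> -> ww; split=> // y; rewrite inE => /predU1P[->//|ys]; exact: ww.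
Qed.

Lemma pos_segment (x z : W) (l : R) j :
  pos (x + l *: (z - x)) j = pos x j + l * (pos z j - pos x j).
Proof. by rewrite /pos mulmxDl -scalemxAl mulmxBl !mxE; ring. Qed.

Lemma pos_inj y z : pos y =1 pos z -> y = z.
Proof.
move=> yz; apply: (row_free_inj B_free); apply/rowP => j.
exact: (addIr (- beta 0 j) (yz j)).
Qed.

Definition barycentric (z : W) (s : seq W) (w : W -> R) : Prop :=
  [/\ flag s, {in s, forall y, 0 <= w y}, \sum_(y <- s) w y = 1
    & \sum_(y <- s) w y *: y = z].

Section Existence.
Let free_coords (z : W) : {pred 'I_p} :=
  [pred j | Num.floor (pos z j) != Num.ceil (pos z j)].

Let face_le_free y z : face_le y z -> free_coords y \subset free_coords z.
Proof.
move=> /forallP yz; apply/fintype.subsetP => j; rewrite !inE; apply: contra => /eqP e.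
case/andP: (yz j); rewrite e => a b.
by apply/eqP/le_anti; rewrite floor_le_ceil (le_trans b a).
Qed.

Lemma face_exit z : z != center z -> exists (l : R) (y : W),
  [/\ 1 < l, y = center z + l *: (z - center z), face_lt y z
    & (#|free_coords y| < #|free_coords z|)%N].
Proof.
move=> zc; set c := center z.
have /same_faceP cz : same_face c z by exact: same_face_center.
pose du j := pos z j - pos c j.
have [j0 dj0] : exists j, du j != 0.
  apply/existsP; apply: contraNT zc => /existsPn d0; apply/eqP/pos_inj => j.
  by apply/eqP; rewrite -subr_eq0; have := d0 j; rewrite negbK.
pose T j := if 0 < du j then ((Num.ceil (pos z j))%:~R - pos c j) / du j
            else ((Num.floor (pos z j))%:~R - pos c j) / du j.
have [j dj Tmin] := @arg_minP _ _ _ j0 (fun j => du j != 0) T dj0.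
have fl (x : R) : (Num.floor x)%:~R <= x by exact: floor_le.
have ce (x : R) : x <= (Num.ceil x)%:~R by exact: ceil_ge.
have flc k : (Num.floor (pos z k))%:~R <= pos c k by rewrite -(cz k).1.
have cec k : pos c k <= (Num.ceil (pos z k))%:~R by rewrite -(cz k).2.
have T1 k : du k != 0 -> 1 < T k.
  rewrite neq_lt /T => /orP[dk|dk].
    rewrite (lt_gtF dk) ltr_ndivlMr// mul1r /du ltrD2r.
    rewrite lt_neqAle fl andbT; apply/negP => /eqP e.
    by have := cec k; rewrite -e intrKceil e leNgt -subr_lt0 dk.
  rewrite dk ltr_pdivlMr// mul1r /du ltrD2r.
  rewrite lt_neqAle ce andbT; apply/negP => /eqP e.
  by have := flc k; rewrite {1}e intrKfloor -e leNgt -subr_gt0 dk.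
have l1 := T1 j dj; set l := T j in l1; set y := c + l *: (z - c).
have l0 : 0 < l by exact: lt_trans l1.
have yE k : pos y k = pos c k + l * du k by rewrite pos_segment.
have yz : face_le y z.
  apply/face_leP => k; rewrite yE.
  have [dk|dk|dk] := ltgtP (du k) 0.
  - apply/andP; split; last first.
      by rewrite (le_trans _ (cec k))// gerDl pmulr_rle0// ltW.
    have := Tmin k; rewrite lt_eqF// => /(_ isT).
    rewrite -/l /T (lt_gtF dk) ler_ndivlMr//; lra.
  - apply/andP; split.
      by rewrite (le_trans (flc k))// lerDl pmulr_rge0// ltW.
    have := Tmin k; rewrite gt_eqF// => /(_ isT).
    rewrite -/l /T dk ler_pdivlMr//; lra.
  - by rewrite dk mulr0 addr0 flc cec.
have yj : (j \notin free_coords y) && (j \in free_coords z).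
  rewrite !inE negbK; apply/andP; split.
    have [m mE] : exists m : int, pos y j = m%:~R.
      rewrite yE /l /T; case: ifP => _; rewrite divfK// addrC subrK; by eexists.
    by rewrite mE intrKfloor intrKceil.
  apply: contra dj => /eqP e; rewrite subr_eq0; apply/eqP/le_anti.
  by rewrite (le_trans (ce _)) -?e ?flc// (le_trans (cec _))// -e fl.
have pr : (#|free_coords y| < #|free_coords z|)%N.
  apply/proper_card/properP; split; first exact: face_le_free.
  by case/andP: yj => yj zj; exists j.
exists l, y; split=> //; rewrite /face_lt yz; apply: contraL pr => zy.
by rewrite -leqNgt; apply/subset_leq_card/face_le_free.
Qed.

Lemma barycentric_ex z : exists s w,
  {in center z :: s, forall y, 0 < w y} /\ barycentric z (center z :: s) w.
Proof.
have [m] := ubnP #|free_coords z|; elim: m z => // m IHm z zm.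
have [zc|zc] := eqVneq z (center z).
  exists [::], (fun _ => 1); split=> // ; split=> //.
  - by apply/andP; split=> //; apply/andP; split=> //; apply/eqP; exact: centerK.
  - by rewrite big_seq1.
  - by rewrite big_seq1 scale1r.
have [l [y [l1 yE yz ym]]] := face_exit zc.
have [s [w [w0 [F _ w1 wy]]]] := IHm y (leq_trans ym zm).
set c := center z in zc yE *.
have l0 : 0 < l by exact: lt_trans l1.
have lt_c x : x \in center y :: s -> face_lt x c.
  move=> xs; have xy : face_le x (center y).
    move: xs; rewrite inE => /predU1P[->|/(flag_le F)/face_lt_le//].
    exact: face_le_refl.
  have /andP[yy _] := same_face_center y; have /andP[_ zz] := same_face_center z.
  have /(face_le_lt_trans (face_le_trans xy yy)) yc : face_lt y c.
    case/andP: yz => yz nzy; rewrite /face_lt (face_le_trans yz zz).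
    by apply: contra nzy => cy; apply: face_le_trans zz cy.
  exact: yc.
have cNs x : x \in center y :: s -> (x == c) = false.
  by move=> /lt_c; case: eqP => // ->; rewrite above_irr.
exists (center y :: s), (fun x => if x == c then 1 - l^-1 else l^-1 * w x).
have wE x : x \in center y :: s ->
    (if x == c then 1 - l^-1 else l^-1 * w x) = l^-1 * w x by move=> /cNs ->.
have w0' : {in c :: center y :: s,
    forall x, 0 < if x == c then 1 - l^-1 else l^-1 * w x}.
  move=> x; rewrite inE => /predU1P[->|xs].
    by rewrite eqxx subr_gt0 invf_lt1.
  by rewrite wE// mulr_gt0 ?invr_gt0 ?w0.
split=> //; split.
- case/andP: F => so al; apply/andP; split; apply/andP; split=> //.
    exact: lt_c (mem_head _ _).
  by apply/eqP; exact: centerK.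
- by move=> x /w0' /ltW.
- rewrite big_cons eqxx big_seq; under eq_bigr => x xs do rewrite wE//.
  by rewrite -big_seq -mulr_sumr w1 mulr1 subrK.
- rewrite big_cons eqxx big_seq; under eq_bigr => x xs do rewrite wE// -scalerA.
  rewrite -big_seq -scaler_sumr wy yE scalerDr scalerA mulVf ?gt_eqF// scale1r.
  by rewrite scalerBl scale1r addrA subrK addrC subrK.
Qed.

End Existence.

Lemma same_face_segment y z (t : R) : face_le y z -> 0 < t <= 1 ->
  same_face (y + t *: (z - y)) z.
Proof.
move=> /face_leP yz /andP[t0 t1]; apply/same_faceP => j; have := yz j.
rewrite pos_segment.
set a := Num.floor (pos z j); set b := Num.ceil (pos z j) => /andP[ay yb].
have /andP[az za] : (a%:~R <= pos z j < (a + 1)%:~R) by exact: floor_itv.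
have /andP[bz zb] : ((b - 1)%:~R < pos z j <= b%:~R) by exact: ceil_itv.
have ba : (b%:~R : R) <= (a + 1)%:~R by rewrite ler_int ceil_le_int ltW.
have ab : ((b - 1)%:~R : R) <= a%:~R.
  by rewrite ler_int lerBlDr -(ler_int R).
have comb (u v : R) : 0 <= u -> 0 < v -> 0 < (1 - t) * u + t * v.
  by move=> u0 v0; rewrite ltr_wpDl ?mulr_ge0 ?mulr_gt0// subr_ge0.
have wcomb (u v : R) : 0 <= u -> 0 <= v -> 0 <= (1 - t) * u + t * v.
  by move=> u0 v0; rewrite addr_ge0 ?mulr_ge0 ?subr_ge0// ltW.
split; apply/eqP; rewrite ?floor_eq ?ceil_eq; apply/andP; split.
- rewrite -subr_ge0.
  by apply: (le_trans (wcomb (pos y j - a%:~R) (pos z j - a%:~R) _ _)); lra.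
- rewrite -subr_gt0; set c := (a + 1)%:~R in ba za *.
  by apply: (lt_le_trans (comb (c - pos y j) (c - pos z j) _ _)); lra.
- rewrite -subr_gt0; set c := (b - 1)%:~R in ab bz *.
  by apply: (lt_le_trans (comb (pos y j - c) (pos z j - c) _ _)); lra.
- rewrite -subr_ge0.
  by apply: (le_trans (wcomb (b%:~R - pos y j) (b%:~R - pos z j) _ _)); lra.
Qed.

Lemma pos_continuous j : continuous (pos ^~ j).
Proof.
have c : continuous (fun y : W => \sum_k y 0 k * (map_mx intr B : 'M[R]_(N, p)) k j).
  apply: continuous_big => [|k _ y]; first exact: add_continuous.
  apply: (@continuousM _ W (fun y : W => y 0 k) (fun=> _)).
    exact: coord_continuous.
  exact: cst_continuous.
rewrite (_ : pos ^~ j =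
    fun y : W => \sum_k y 0 k * (map_mx intr B : 'M[R]_(N, p)) k j - beta 0 j).
  move=> z; apply: (@continuousB R R W _ (fun=> beta 0 j)); first exact: c.
  exact: cst_continuous.
by apply/funext => y; rewrite /pos mxE.
Qed.

Let bounded_face (m : nat) (y : W) : Prop := forall j,
  - m%:Z <= Num.floor (pos y j) /\ Num.ceil (pos y j) <= m%:Z.

Let finite_centers m :
  finite_set [set y | center y = y /\ bounded_face m y].
Proof.
set S := [set y | _].
pose code y : {ffun 'I_p -> 'I_(m + m).+1 * 'I_(m + m).+1} :=
  [ffun j => (inord (absz (Num.floor (pos y j) + m%:Z)),
              inord (absz (Num.ceil (pos y j) + m%:Z)))].
pose dec c := xget 0 [set y | S y /\ code y = c].
apply: (@sub_finite_set _ _ (range dec)); last first.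
  by apply: finite_image; exact: finite_finset.
move=> y Sy; exists (code y) => //; rewrite /dec.
have [|Sx xy] := @xgetPex _ 0 [set x | S x /\ code x = code y].
  by exists y.
set x := xget _ _ in Sx xy *.
have E k l : - m%:Z <= k <= m%:Z -> - m%:Z <= l <= m%:Z ->
    inord (absz (k + m%:Z)) = inord (absz (l + m%:Z)) :> 'I_(m + m).+1 -> k = l.
  move=> km lm /(congr1 val); rewrite /= !inordK; [lia|lia|lia].
case: Sx Sy => cx bx [cy bY]; rewrite -cx -cy; apply/center_eq/same_faceP => j.
have [xf xc] := bx j; have [yf yc] := bY j.
have := floor_le_ceil (pos x j); have := floor_le_ceil (pos y j) => fy fx.
move/ffunP/(_ j): xy; rewrite !ffunE => -[].
by split; apply: E => //; lia.
Qed.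

Let finite_flags m :
  finite_set [set s | flag s /\ {in s, forall y, bounded_face m y}].
Proof.
have /finite_seqP[e eE] := finite_centers m.
pose g (t : (size e).-bseq 'I_(size e)) : seq W := [seq e`_i | i : 'I_(size e) <- t].
apply: (@sub_finite_set _ _ (range g)).
  move=> s /= [F sb].
  have se y : y \in s -> y \in e.
    move=> ys; have : [set` e] y.
      rewrite -eE; split; last exact: sb.
      by case/andP: F => _ /allP /(_ _ ys) /eqP.
    by [].
  have sz : (size s <= size e)%N by apply: uniq_leq_size; [exact: flag_uniq|].
  have [->|[y0 y0s]] : s = [::] \/ exists y, y \in s.
    by case: s {F sb se sz} => [|y s]; [left|right; exists y; rewrite mem_head].
    by exists (@Bseq _ _ [::] isT).
  have e0 : (0 < size e)%N.
    by have := se _ y0s; case: (e).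
  have q : (size [seq Ordinal (ltn_pmod (index y e) e0) | y <- s] <= size e)%N.
    by rewrite size_map.
  exists (Bseq q) => //; rewrite /g /= -map_comp -[RHS]map_id.
  apply/eq_in_map => y ys /=.
  by rewrite modn_small ?index_mem ?se// nth_index// se.
by apply: finite_image; exact: finite_finset.
Qed.

Section Coordinates.
Variable z : W.

Let bflag_ex : exists sw, {in sw.1, forall y, 0 < sw.2 y} /\
  barycentric z sw.1 sw.2 /\ head 0 sw.1 = center z /\ sw.1 != [::].
Proof.
by have [s [w [w0 zsw]]] := barycentric_ex z; exists (center z :: s, w).
Qed.

Definition carrier : seq W := (projT1 (cid bflag_ex)).1.
Definition coordinate : W -> R := (projT1 (cid bflag_ex)).2.

Lemma carrierP : barycentric z carrier coordinate.
Proof. exact: (projT2 (cid bflag_ex)).2.1. Qed.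

Lemma coordinate_gt0 y : y \in carrier -> 0 < coordinate y.
Proof. exact: (projT2 (cid bflag_ex)).1. Qed.

Lemma carrierE : carrier = center z :: behead carrier.
Proof.
have [h n] := (projT2 (cid bflag_ex)).2.2.
by move: h n; rewrite /carrier; case: (projT1 _).1 => //= x s <-.
Qed.

Lemma carrier_face_le y : y \in carrier -> face_le y z.
Proof.
have /andP[cz _] := same_face_center z.
have [F _ _ _] := carrierP; move: F; rewrite carrierE => F.
rewrite inE => /predU1P[->//|/(flag_le F)/face_lt_le yc].
exact: face_le_trans yc cz.
Qed.

Lemma barycentric_carrier s w : barycentric z s w ->
  [seq y <- s | 0 < w y] = carrier /\ {in carrier, w =1 coordinate}.
Proof.
case=> F w0 w1 wz; have [F' _ c1 cz] := carrierP.
have wE : {in s, forall y, (0 < w y) = (w y != 0)}.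
  by move=> y /w0 wy; rewrite lt_def wy andbT.
have [||||||-> //] := @flag_coord_uniq [seq y <- s | 0 < w y] carrier w coordinate.
- exact: flag_filter.
- exact: F'.
- by move=> y; rewrite mem_filter => /andP[].
- exact: coordinate_gt0.
- rewrite big_filter c1 -[RHS]w1 [RHS](bigID (fun y => 0 < w y))/=.
  rewrite [X in _ + X]big_seq_cond [X in _ + X]big1 ?addr0// => y /andP[ys].
  by rewrite wE// negbK => /eqP.
- rewrite big_filter cz -[RHS]wz [RHS](bigID (fun y => 0 < w y))/=.
  rewrite [X in _ + X]big_seq_cond [X in _ + X]big1 ?addr0// => y /andP[ys].
  by rewrite wE// negbK => /eqP ->; rewrite scale0r.
Qed.

End Coordinates.

Lemma flag_translate s v : flag s -> flag [seq y + 'i v | y <- s].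
Proof.
move=> /andP[so al]; apply/andP; split.
  rewrite sorted_map; apply: sub_sorted so => x y.
  by rewrite /= /face_lt !face_le_translate.
apply/allP => _ /mapP[y ys ->]; rewrite center_translate.
by apply/eqP; congr (_ + _); apply/eqP; exact: (allP al).
Qed.

Lemma carrier_translate z v :
  carrier (z + 'i v) = [seq y + 'i v | y <- carrier z] /\
  {in carrier z, forall y, coordinate (z + 'i v) (y + 'i v) = coordinate z y}.
Proof.
have [F c0 c1 cz] := carrierP z.
have [|] := @barycentric_carrier (z + 'i v) [seq y + 'i v | y <- carrier z]
  (fun y => coordinate z (y - 'i v)).
  split.
  - exact: flag_translate.
  - by move=> _ /mapP[y ys ->]; rewrite addrK c0.
  - by rewrite big_map -[RHS]c1; apply: eq_bigr => y _; rewrite addrK.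
  - rewrite big_map -[in RHS]cz -['i v in RHS]scale1r -c1 scaler_suml -big_split.
    by apply: eq_bigr => y _; rewrite addrK scalerDr.
rewrite (_ : [seq y <- _ | _] = [seq y + 'i v | y <- carrier z]); last first.
  apply/all_filterP/allP => _ /mapP[y ys ->]; rewrite addrK.
  exact: coordinate_gt0.
move=> <- cE; split=> // y ys.
by have := cE (y + 'i v) (map_f _ ys); rewrite addrK => ->.
Qed.

Definition simplex_points m : set 'rV[R]_m :=
  [set t | (forall k, 0 <= t 0 k) /\ \sum_k t 0 k = 1].

Lemma sum_coord_continuous m (V : normedModType R) (f : 'I_m -> V) :
  continuous (fun t : 'rV[R]_m => \sum_k t 0 k *: f k).
Proof.
apply: continuous_big => [|k _ t]; first exact: add_continuous.
apply: (@continuousZr_tmp R V 'rV[R]_m (fun t => t 0 k) (f k)).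
exact: coord_continuous.
Qed.

Lemma simplex_points_compact m : compact (@simplex_points m).
Proof.
apply: (@subclosed_compact _ _
  [set t : 'rV[R]_m | forall k, `[0, 1]%classic (t 0 k)]).
- rewrite (_ : @simplex_points m =
    (\bigcap_k (fun t : 'rV[R]_m => t 0 k) @^-1` [set x | 0 <= x]) `&`
    (fun t : 'rV[R]_m => \sum_k t 0 k *: (1 : R)) @^-1` [set 1]).
    apply: closedI; last first.
      by apply: preimage_closed => [t _|];
        [exact: sum_coord_continuous | exact: closed_eq].
    apply: closed_bigI => k _; apply: preimage_closed => [t _|].
      exact: coord_continuous.
    exact: closed_ge.
  have sE (t : 'rV[R]_m) : \sum_k t 0 k *: (1 : R) = \sum_k t 0 k.
    by apply: eq_bigr => k _; exact: mulr1.
  apply/seteqP; split=> t /= [t0 t1].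
    by split=> [k _|]; [exact: t0|rewrite sE].
  by split=> [k|]; [exact: t0|rewrite -sE].
- apply: (@rV_compact R m (fun=> `[0, 1]%classic)) => _.
  exact: segment_compact.
- move=> t [t0 t1] k; rewrite /= in_itv /= t0 /= -t1 (bigD1 k)//= lerDl.
  by apply: sumr_ge0.
Qed.

Definition flag_point (s : seq W) (t : 'rV[R]_(size s)) : W :=
  \sum_k t 0 k *: s`_k.

(* The flags of a bounded region are finitely many and their simplices are
   compact, so that continuity may be tested on each simplex. *)
Lemma continuous_flagwise (Y : topologicalType) (f : W -> Y) (z0 : W) :
  (forall s (t : 'rV[R]_(size s)), flag s -> simplex_points t ->
     flag_point t = z0 ->
     f (flag_point t') @[t' --> within (@simplex_points _) (nbhs t)] --> f z0) ->
  {for z0, continuous f}.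
Proof.
move=> fc A Af.
have [m mP] : exists m : nat, forall j, `|pos z0 j| < m%:R.
  exists (\sum_j (Num.truncn `|pos z0 j|).+1)%N => j.
  apply: (lt_le_trans (truncnS_gt _)); rewrite ler_nat (bigD1 j)//=.
  exact: leq_addr.
have nb : \forall z \near z0, bounded_face m z.
  have : \forall z \near z0, forall j, `|pos z j| < m%:R.
    apply: (@filter_forall _ _ _ (nbhs z0)) => j.
    have c : {for z0, continuous (fun z => `|pos z j|)}.
      by apply: continuous_comp; [exact: pos_continuous|exact: norm_continuous].
    exact: (c [set x | x < m%:R] (lt_nbhsl (mP j))).
  apply: filterS => z zm j; move: (zm j); rewrite ltr_norml => /andP[/ltW a /ltW b].
  by rewrite floor_ge_int ceil_le_int intrN.
set S := [set s | flag s /\ {in s, forall y, bounded_face m y}].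
pose Z s := closure [set t | @simplex_points (size s) t /\ ~ A (f (flag_point t))].
have ZS s : Z s `<=` @simplex_points (size s).
  rewrite [X in _ `<=` X](closure_id _).1; last first.
    apply: compact_closed; last exact: simplex_points_compact.
    exact: norm_hausdorff.
  by apply: closureS => t [].
pose D := \bigcup_(s in S) (@flag_point s @` Z s).
have Dc : closed D.
  apply: closed_bigcup; first exact: finite_flags.
  move=> s _; apply: compact_closed; first exact: norm_hausdorff.
  apply: continuous_compact.
    exact/continuous_subspaceT/sum_coord_continuous.
  apply: (subclosed_compact _ (@simplex_points_compact (size s)) (@ZS s)).
  exact: closed_closure.
have Dz : ~ D z0.
  move=> [s [F _] [t Zt tz]].
  have := fc s t F (ZS _ _ Zt) tz _ Af; rewrite /= /within /= => At.
  have [u [[us uA] uN]] := Zt _ At.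
  by apply: uA; exact: uN.
have nD : \forall z \near z0, ~ D z.
  by apply: open_nbhs_nbhs; split=> //; rewrite openC.
apply: (@filterS2 _ (nbhs z0) _ _ _ _ _ nD nb) => z zD zm.
apply: contrapT => nA; apply: zD.
have [F c0 c1 cz] := carrierP z.
pose t : 'rV[R]_(size (carrier z)) := \row_k coordinate z (carrier z)`_k.
have tz : flag_point t = z.
  rewrite -[RHS]cz /flag_point (big_nth 0) big_mkord.
  by apply: eq_bigr => k _; rewrite mxE.
exists (carrier z).
  split=> // y /carrier_face_le /forallP yz j; have [a b] := zm j.
  have /andP[c d] := yz j.
  by split; [exact: le_trans a c|exact: le_trans d b].
exists t => //; apply: subset_closure; split; last by rewrite tz.
split=> [k|].
  by rewrite mxE ltW// coordinate_gt0// mem_nth.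
rewrite -[RHS]c1 (big_nth 0) big_mkord.
by apply: eq_bigr => k _; rewrite mxE.
Qed.

End LatticeArrangement.

(** * Points of the realization *)

Lemma cvg_set_val (X : topologicalType) (A : set X) (T : Type) (F : set_system T)
    (f : T -> A) (a : A) : Filter F ->
  set_val (f x) @[x --> F] --> set_val a -> f x @[x --> F] --> a.
Proof.
move=> FF fa U [_ [[V oV <-] /= Va] VU]; apply: filterS VU _.
by apply: fa; exact: open_nbhs_nbhs.
Qed.

Lemma cvg_row (X : topologicalType) m (T : Type) (F : set_system T)
    (f : T -> 'rV[X]_m) (a : 'rV[X]_m) : Filter F ->
  (forall k, f x 0 k @[x --> F] --> a 0 k) -> f x @[x --> F] --> a.
Proof.
move=> FF fa U [P aP PU]; apply: (@filterS _ F _ _ _ (fun x => PU (f x))).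
suff : \forall x \near F, forall k, P 0 k (f x 0 k).
  by apply: filterS => x Px i j; rewrite ord1.
by apply: filter_forall => k; exact: fa.
Qed.

Section RealizationPoints.
Variables (R : realType) (C : category).

Definition normalized m (w : nat -> R) : 'rV[R]_m.+1 :=
  if \sum_(k < m.+1) `|w k| == 0 then delta_mx 0 0
  else \row_(k < m.+1) (`|w k| / \sum_(l < m.+1) `|w l|).

Lemma normalized_simplex m w : std_simplex R m (normalized m w).
Proof.
rewrite /normalized; case: eqVneq => [_|s0]; split.
- by move=> k; rewrite mxE eqxx; case: (_ == _); rewrite ?ler01 ?lexx.
- rewrite (bigD1 0)//= mxE !eqxx big1 ?addr0// => k k0.
  by rewrite mxE (negbTE k0) andbF.
- by move=> k; rewrite mxE divr_ge0// sumr_ge0.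
- by under eq_bigr => k _ do rewrite mxE; rewrite -mulr_suml divff.
Qed.

Definition weighted_simplex (c : chain C) (w : nat -> R) : simplices R C :=
  existT (fun c => simplex_of R c : Type) c
    (SigSub (mem_set (normalized_simplex (Defs.dim c) w)) : std_simplex R (Defs.dim c)).

Definition weighted_point (c : chain C) (w : nat -> R) : realization R C :=
  \pi_(realization R C)%qT (weighted_simplex c w).

Lemma coord_weighted (c : chain C) (w : nat -> R) k :
  \sum_(l < (Defs.dim c).+1) `|w l| != 0 ->
  Defs.coord (weighted_simplex c w) k =
  if (k < (Defs.dim c).+1)%N then `|w k| / \sum_(l < (Defs.dim c).+1) `|w l| else 0.
Proof.
move=> s0; rewrite /Defs.coord /=; case: insubP => [i ik <-|/negbTE ->//].
by rewrite ltn_ord /= /normalized (negbTE s0) mxE.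
Qed.

Lemma weighted_point_cvg (T : Type) (F : set_system T) (c : chain C)
    (w : T -> nat -> R) (l : nat -> R) : Filter F ->
  (forall k, w x k @[x --> F] --> l k) ->
  \sum_(k < (Defs.dim c).+1) `|l k| != 0 ->
  weighted_point c (w x) @[x --> F] --> weighted_point c l.
Proof.
move=> FF wl l0.
have sl : \sum_(k < (Defs.dim c).+1) `|w x k| @[x --> F] -->
          \sum_(k < (Defs.dim c).+1) `|l k|.
  apply: cvg_big => [|k _]; first exact: add_continuous.
  by apply: cvg_norm; exact: wl.
pose S x : simplex_of R c := SigSub (mem_set (normalized_simplex (Defs.dim c) x)).
suff Sl : S (w x) @[x --> F] --> S l.
  have Wl : weighted_simplex c (w x) @[x --> F] --> weighted_simplex c l.
    by move=> U Ul; exact: (Sl (existT _ c @^-1` U) Ul).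
  exact: (cvg_comp _ _ Wl (@pi_continuous _ _ (weighted_simplex c l))).
apply: cvg_set_val; apply: cvg_row => k /=.
have nz : \forall x \near F, \sum_(k < (Defs.dim c).+1) `|w x k| != 0.
  exact: cvgr_neq0 sl l0.
rewrite set_valE.
change (normalized (Defs.dim c) (w x) 0 k @[x --> F] -->
        normalized (Defs.dim c) l 0 k).
rewrite {2}/normalized (negbTE l0) mxE.
apply: (@cvg_trans _ ((`|w x k| / \sum_(k < (Defs.dim c).+1) `|w x k|) @[x --> F])).
  apply: near_eq_cvg; apply: filterS nz => x nx.
  by rewrite /normalized (negbTE nx) mxE.
by apply: cvgM; [apply: cvg_norm; exact: wl | exact: cvgV].
Qed.

Lemma weighted_point_coord (p : simplices R C) :
  \pi_(realization R C)%qT p = weighted_point (projT1 p) (Defs.coord p).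
Proof.
case: p => c [t tS]; rewrite /weighted_point /weighted_simplex /=.
congr (\pi_(realization R C)%qT (existT _ c _)); apply: val_inj => /=.
have [t0 t1] := set_mem tS.
have cE (k : 'I_(Defs.dim c).+1) :
    Defs.coord (existT (fun c => simplex_of R c : Type) c (exist _ t tS)) k = t 0 k.
  by rewrite /Defs.coord /= insubT //= => ?; congr (t 0 _); apply: val_inj.
have s1 : \sum_(k < (Defs.dim c).+1) `|Defs.coord
    (existT (fun c => simplex_of R c : Type) c (exist _ t tS)) k| = 1.
  by rewrite -[RHS]t1; apply: eq_bigr => k _; rewrite cE ger0_norm.
rewrite /normalized s1 oner_eq0; apply/rowP => k.
by rewrite !mxE cE divr1 ger0_norm.
Qed.

Lemma chain_face_size i (c c' : C * seq (arrow C)) : chain_face i c c' ->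
  size c.2 = (size c'.2).+1 /\ (i <= size c.2)%N.
Proof.
case=> [x a s|x s a|x s a b ab s' _] /=; first by [].
- by rewrite size_rcons.
- rewrite !size_cat /= !addnS; split=> //; lia.
Qed.

Lemma weighted_point_face i (c c' : chain C) (w : nat -> R) :
  chain_face i (sval c) (sval c') -> w i = 0 ->
  \sum_(k < (Defs.dim c).+1) `|w k| != 0 ->
  weighted_point c w = weighted_point c' (fun k => w (bump i k)).
Proof.
move=> cc wi s0; have [dE ile] := chain_face_size cc.
have sE : \sum_(k < (Defs.dim c).+1) `|w k| =
    \sum_(k < (Defs.dim c').+1) `|w (bump i k)|.
  have i1 : (i < (Defs.dim c').+2)%N by rewrite ltnS /Defs.dim -dE.
  rewrite /Defs.dim dE (bigD1_ord (Ordinal i1))//= wi normr0 add0r.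
  by apply: eq_bigr.
apply/eqmodP/asboolP/rst_step; exists i; split=> //=.
- by rewrite coord_weighted// wi normr0 mul0r if_same.
- move=> k; rewrite !coord_weighted -?sE//.
  rewrite (_ : (bump i k < (Defs.dim c).+1)%N = (k < (Defs.dim c').+1)%N)//.
  by rewrite /Defs.dim dE /bump; move: ile; rewrite dE; case: leqP => /=; lia.
Qed.

Lemma realization_lift (Y : topologicalType) (f : simplices R C -> Y) :
  (forall p q, glued p q -> f p = f q) ->
  exists g : realization R C -> Y,
    (forall p, g (\pi_(realization R C)%qT p) = f p) /\
    ((forall c, continuous (fun t : simplex_of R c => f (existT _ c t))) ->
     continuous g).
Proof.
move=> fglued; exists (f \o repr).
have fE p q : \pi_(realization R C)%qT p = \pi_(realization R C)%qT q -> f p = f q.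
  move=> /eqmodP /asboolP; elim=> [x y /fglued//|//|x y _ ->//|x y z _ -> _ ->//].
split=> [p|fc]; first by apply: fE; rewrite reprK.
apply: repr_comp_continuous => [[c t]|p q /eqP pq].
  move=> U fU; rewrite /nbhs /= sigT_nbhsE /=; exact: fc.
by apply/eqP/fE.
Qed.

End RealizationPoints.

(** * Faces and cells *)

Section SignSequences.
Variable R : realType.

Lemma sg_floor_ceil (s t : R) :
  (forall m : int, Num.sg (s - m%:~R) = Num.sg (t - m%:~R)) <->
  Num.floor s = Num.floor t /\ Num.ceil s = Num.ceil t.
Proof.
split=> [st|[fE cE] m].
  have ge (m : int) : (m%:~R <= s) = (m%:~R <= t) 
    by rewrite -[LHS]subr_ge0 -[RHS]subr_ge0 -[LHS]sgr_ge0 -[RHS]sgr_ge0 st.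
  have le (m : int) : (s <= m%:~R) = (t <= m%:~R) 
    by rewrite -[LHS]subr_le0 -[RHS]subr_le0 -[LHS]sgr_le0 -[RHS]sgr_le0 st.
  split; apply/le_anti/andP; split; rewrite ?floor_ge_int ?ceil_le_int.
  - by rewrite -ge floor_le.
  - by rewrite ge floor_le.
  - by rewrite le ceil_ge.
  - by rewrite -le ceil_ge.
have ge : (m%:~R <= s) = (m%:~R <= t) by rewrite -!floor_ge_int fE.
have le : (s <= m%:~R) = (t <= m%:~R) by rewrite -!ceil_le_int cE.
have lt : (s < m%:~R) = (t < m%:~R) by rewrite !ltNge ge.
have gt : (m%:~R < s) = (m%:~R < t) by rewrite !ltNge le.
have [sm|sm|sm] := ltgtP s m%:~R.
- by rewrite !ltr0_sg// subr_lt0 -?lt.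
- by rewrite !gtr0_sg// subr_gt0 -?gt.
- have -> : t = m%:~R by apply/le_anti; rewrite -ge -le sm lexx.
  by rewrite sm.
Qed.

End SignSequences.

Section ToricFaces.
Variables (R : realType) (d n : nat) (A : 'M[int]_(d, n)).
Variable b : 'I_n -> circle R.
Hypothesis A_rank : \rank (map_mx (intr : int -> rat) A) = d.
Local Notation V := 'rV[R]_d.
Local Notation "''i' v" := (map_mx intr v : V) (at level 10, v at level 9).

Definition offset : 'rV[R]_n := \row_j repr (b j).

Lemma row_free_intr : row_free (map_mx intr A : 'M[R]_(d, n)).
Proof.
rewrite /row_free -[X in _ == X]A_rank -(mxrank_map (ratr : rat -> R)).
by rewrite -map_mx_comp; apply/eqP; congr (\rank _); apply/matrixP => i j;
  rewrite !mxE /= ratr_int.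
Qed.

Lemma pos_offset (x : V) j :
  pos A offset x j = character (col j A) x - repr (b j).
Proof.
rewrite /pos !mxE; congr (_ - _); apply: eq_bigr => k _.
by rewrite !mxE mulrzr.
Qed.

Lemma face_of_same x y : face_of A b x y <-> same_face A offset x y.
Proof.
split=> [/face_ofP xy|/same_faceP xy].
  apply/same_faceP => j.
  apply/sg_floor_ceil => m; have := xy j (repr (b j) + m%:~R).
  by rewrite !pos_offset circle_shift reprK !opprD !addrA => ->.
apply/face_ofP => j beta bE.
have /quotient_groupP/intrP[m mE] :
    \pi_(circle R)%qT beta = \pi_(circle R)%qT (repr (b j)) by rewrite reprK.
have /sg_floor_ceil /(_ m) := xy j.
have -> : beta = repr (b j) + m%:~R by rewrite -mE addrC subrK.
by rewrite !pos_offset !opprD !addrA.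
Qed.

Lemma face_of_eqP x y : face_of A b x = face_of A b y <-> same_face A offset x y.
Proof.
split=> [xy|/face_of_same/face_of_eq//].
by apply/face_of_same; rewrite xy; exact: face_of_refl.
Qed.

Lemma closure_face_le x y :
  face_of A b x `<=` closure (face_of A b y) <-> face_le A offset x y.
Proof.
split=> [xy|xy].
  apply/face_leP => j; have cl := closure_face_of (xy _ (face_of_refl x)).
  have cj (m : int) := cl j (repr (b j) + m%:~R).
  have {}cj (m : int) : Num.sg (pos A offset x j - m%:~R) = 0 \/
      Num.sg (pos A offset x j - m%:~R) = Num.sg (pos A offset y j - m%:~R).
    rewrite !pos_offset -!addrA -!opprD; apply: cj.
    by rewrite circle_shift reprK.
  apply/andP; split.
    have [/eqP|e] := cj (Num.floor (pos A offset y j)).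
      by rewrite sgr_eq0 subr_eq0 => /eqP ->.
    by rewrite -subr_ge0 -sgr_ge0 e sgr_ge0 subr_ge0 floor_le.
  have [/eqP|e] := cj (Num.ceil (pos A offset y j)).
    by rewrite sgr_eq0 subr_eq0 => /eqP ->.
  by rewrite -subr_le0 -sgr_le0 e sgr_le0 subr_le0 ceil_ge.
move=> u /face_of_same xu O nO.
have uy : face_le A offset u y.
  by apply: face_le_trans xy; rewrite same_face_sym in xu; case/andP: xu.
have c : {for (0 : R), continuous (fun t : R => u + t *: (y - u))}.
  apply: (@continuousD R V R (fun=> u) (fun t => t *: (y - u))).
    exact: cst_continuous.
  exact: (@continuousZr_tmp R V R (fun t => t) (y - u)).
have /c nt : nbhs (u + 0 *: (y - u)) O by rewrite scale0r addr0.
have [e /= e0 eO] : nbhs (0 : R) [set t | O (u + t *: (y - u))] by exact: nt.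
pose t := Num.min 1 (e / 2).
have t0 : 0 < t by rewrite lt_min ltr01 divr_gt0.
have t1 : t <= 1 by rewrite ge_min lexx.
exists (u + t *: (y - u)); split; last first.
  apply: eO; rewrite /ball /= sub0r normrN gtr0_norm//.
  by rewrite gt_min orbC ltr_pdivrMr// mulr2n mulrDr mulr1 ltrDl e0.
apply/face_of_same; rewrite same_face_sym.
by apply: same_face_segment => //; rewrite t0.
Qed.

Definition cell_of (x : V) : cell A b :=
  exist _ (face_orbit (face_of A b x))
    (ex_intro2 _ _ (face_of A b x) (ex_intro2 _ _ x I erefl) erefl).

Lemma cell_of_face x : sval (cell_of x) (face_of A b x).
Proof. by exists 0 => //; rewrite translate0. Qed.

Lemma cell_of_surj (F : cell A b) : exists x, F = cell_of x.
Proof.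
have [P [x _ <-] FE] := svalP F; exists x.
apply: (@cell_eq _ _ _ _ _ _ _ (face_of A b x)); last exact: cell_of_face.
by rewrite FE; exists 0 => //; rewrite translate0.
Qed.

Lemma cell_of_mem x P : sval (cell_of x) P -> exists v, P = face_of A b (x + 'i v).
Proof. by case=> v _ <-; exists v; rewrite translate_face_of. Qed.

Lemma cell_of_eqP x y :
  cell_of x = cell_of y <-> exists v, same_face A offset y (x + 'i v).
Proof.
split=> [xy|[v /face_of_eqP yx]].
  have := cell_of_face y; rewrite -xy => /cell_of_mem[v vE].
  by exists v; apply/face_of_eqP.
apply: (@cell_eq _ _ _ _ _ _ _ (face_of A b y)); last exact: cell_of_face.
by rewrite yx -translate_face_of; exact/cell_translate/cell_of_face.
Qed.

Fact face_morphism_subproof x y (xy : face_le A offset x y) : exists P Q,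
  [/\ sval (cell_of x) P, sval (cell_of y) Q, P `<=` closure Q
    & pair_orbit (face_of A b x) (face_of A b y) = pair_orbit P Q].
Proof.
exists (face_of A b x), (face_of A b y).
by split=> //; [exact: cell_of_face..|exact/closure_face_le].
Qed.

Definition face_morphism x y (xy : face_le A offset x y) :
    cell_morphism (cell_of x) (cell_of y) :=
  exist _ _ (face_morphism_subproof xy).

Lemma pair_orbit_shift x y v :
  pair_orbit (face_of A b (x + 'i v)) (face_of A b (y + 'i v)) =
  pair_orbit (face_of A b x) (face_of A b y).
Proof.
rewrite -!translate_face_of; apply/seteqP; split=> _ [w _ <-].
  by exists (w + v) => //; rewrite !translateD.
by exists (w - v) => //; rewrite !translateD subrK.
Qed.

Lemma face_morphism_surj y (F : cell A b) (m : cell_morphism F (cell_of y)) :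
  exists2 x, face_le A offset x y &
    F = cell_of x /\ sval m = pair_orbit (face_of A b x) (face_of A b y).
Proof.
case: m => m /= [P [Q [FP /cell_of_mem[v ->] + ->]]].
have [x0 FE] := cell_of_surj F; rewrite FE in FP *.
case/cell_of_mem: FP => w -> PQ.
exists (x0 + 'i w - 'i v).
  rewrite -(face_le_translate _ _ _ _ v) subrK; exact/closure_face_le.
split; last by rewrite -[LHS](pair_orbit_shift _ _ (- v)) map_mxN addrK.
apply/cell_of_eqP; exists (w - v).
by rewrite map_mxD map_mxN addrA same_face_refl.
Qed.

Lemma pair_orbit_inj x x' y :
  pair_orbit (face_of A b x) (face_of A b y) =
  pair_orbit (face_of A b x') (face_of A b y) -> same_face A offset x x'.
Proof.
move=> e; have : pair_orbit (face_of A b x) (face_of A b y)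
  (face_of A b x, face_of A b y) by exists 0 => //; rewrite !translate0.
rewrite e => -[v _ [xE yE]].
have v0 : v = 0.
  apply: (translate_inj A_rank (P := face_of A b y)); last by rewrite translate0.
  by exists y.
by apply/face_of_eqP; rewrite -xE v0 translate0.
Qed.

Lemma suppP x y : supp (cell_of x) `&` supp (cell_of y) = set0 <->
  ~ exists j, pos A offset x j \is a Num.int /\ pos A offset y j \is a Num.int.
Proof.
have H j u : cell_set (cell_of u) `<=` toric_hypersurface A b j <->
    pos A offset u j \is a Num.int.
  rewrite pos_offset; split=> [uH|uj].
    have : toric_hypersurface A b j (toric_projection u).
      apply: uH; exists u => //; exists (face_of A b u); first exact: cell_of_face.
      exact: face_of_refl.
    rewrite /toric_hypersurface /= character_projection -{1}(reprK (b j)).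
    by move/quotient_groupP.
  move=> _ [t [P /cell_of_mem[v ->] /face_of_same/same_faceP/(_ j) ut] <-].
  rewrite /toric_hypersurface /= character_projection -[RHS]reprK.
  apply/quotient_groupP; rewrite -pos_offset.
  have : pos A offset (u + 'i v) j \is a Num.int.
    by rewrite pos_translate rpredD ?intr_int// pos_offset.
  rewrite !intrEfloor => /eqP fE.
  have cE : (Num.ceil (pos A offset (u + 'i v) j))%:~R = pos A offset (u + 'i v) j.
    by apply/eqP; rewrite -intrEceil intrEfloor fE.
  case: ut => fut cut; apply/eqP/le_anti; rewrite floor_le/= -fut fE -cE cut.
  exact: ceil_ge.
split=> [xy [j [xj yj]]|xy].
  have : (supp (cell_of x) `&` supp (cell_of y)) (toric_hypersurface A b j).
    by split; split; [exists j|exact/H|exists j|exact/H].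
  by rewrite xy.
apply/seteqP; split=> // Hj [[[j _ <-] /H xj] [_ /H yj]].
by apply: xy; exists j.
Qed.

End ToricFaces.

Section EllipticFaces.
Variables (R : realType) (d n : nat) (A : 'M[int]_(d, n)).
Variable b : 'I_n -> circle R.
Hypothesis A_rank : \rank (map_mx (intr : int -> rat) A) = d.
Local Notation V := 'rV[R]_d.
Local Notation W := 'rV[R]_(d + d).
Local Notation "''i' v" := (map_mx intr v) (at level 10, v at level 9).
Local Notation K := (cell_pair_category b A_rank).
Local Notation off := (offset b).

Definition square_mx : 'M[int]_(d + d, n + n) := block_mx A 0 0 A.
Definition square_offset : 'rV[R]_(n + n) := row_mx off off.
Local Notation B := square_mx.
Local Notation beta := square_offset.

Lemma pos_square (z : W) :
  (forall j, pos B beta z (lshift n j) = pos A off (lsubmx z) j) *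
  (forall j, pos B beta z (rshift n j) = pos A off (rsubmx z) j).
Proof.
by split=> j; rewrite /pos /B /beta map_block_mx !map_mx0 -[in LHS](hsubmxK z)
  mul_row_block !mulmx0 addr0 add0r ?row_mxEl ?row_mxEr.
Qed.

Lemma forall_square (P : pred 'I_(n + n)) :
  [forall j, P j] = [forall j, P (lshift n j)] && [forall j, P (rshift n j)].
Proof.
apply/forallP/andP => [Pj|[/forallP Pl /forallP Pr] j].
  by split; apply/forallP => j; exact: Pj.
by rewrite -(splitK j); case: (fintype.split j) => k /=; [exact: Pl|exact: Pr].
Qed.

Lemma face_le_square y z : face_le B beta y z =
  face_le A off (lsubmx y) (lsubmx z) && face_le A off (rsubmx y) (rsubmx z).
Proof.
rewrite /face_le forall_square.
by congr (_ && _); apply: eq_forallb => j; rewrite !pos_square.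
Qed.

Lemma same_face_square y z : same_face B beta y z =
  same_face A off (lsubmx y) (lsubmx z) && same_face A off (rsubmx y) (rsubmx z).
Proof. by rewrite /same_face !face_le_square andbACA. Qed.

Lemma row_free_square : row_free ('i B : 'M[R]_(d + d, n + n)).
Proof.
rewrite /row_free map_block_mx !map_mx0 rank_diag_block_mx.
by have /eqP -> := row_free_intr R A_rank.
Qed.
Local Notation Bfree := row_free_square.

Lemma sub_translate (z : W) (v : 'rV[int]_(d + d)) :
  (lsubmx (z + 'i v) = lsubmx z + 'i (lsubmx v)) *
  (rsubmx (z + 'i v) = rsubmx z + 'i (rsubmx v)).
Proof. by split; apply/rowP => k; rewrite !mxE. Qed.

Lemma face_le_int (y z : V) j : face_le A off y z ->
  pos A off z j \is a Num.int -> pos A off y j \is a Num.int.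
Proof.
move=> /face_leP /(_ j) yz zint.
have fz := zint; rewrite intrEfloor in fz.
have cz := zint; rewrite intrEceil in cz.
move: yz; rewrite (eqP fz) (eqP cz) => /le_anti <-; exact: zint.
Qed.

Definition disjoint_support (z : W) : bool :=
  [forall j, ~~ ((pos A off (lsubmx z) j \is a Num.int) &&
                 (pos A off (rsubmx z) j \is a Num.int))].
Local Notation U := disjoint_support.

Lemma disjoint_support_face y z : face_le B beta y z -> U y -> U z.
Proof.
rewrite face_le_square => /andP[yl yr] /forallP Uy; apply/forallP => j.
apply: contra (Uy j) => /andP[zl zr].
by rewrite (face_le_int yl zl) (face_le_int yr zr).
Qed.

Lemma disjoint_support_same y z : same_face B beta y z -> U y = U z.
Proof.
by case/andP => yz zy; apply/idP/idP; exact: disjoint_support_face.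
Qed.

Lemma disjoint_support_translate (z : W) v : U (z + 'i v) = U z.
Proof.
apply: eq_forallb => j; rewrite !sub_translate !pos_translate.
by rewrite !(rpredDr _ (intr_int _ _)).
Qed.

Lemma disjoint_support_supp (z : W) : U z ->
  supp (cell_of A b (lsubmx z)) `&` supp (cell_of A b (rsubmx z)) = set0.
Proof.
move=> /forallP Uz; apply/suppP => -[j [zl zr]].
by have := Uz j; rewrite zl zr.
Qed.

Definition vertex := {z : W | U z && (center B beta z == z)}.

Lemma vertexU (z : vertex) : U (val z).
Proof. by case/andP: (valP z). Qed.

Lemma vertex_center (z : vertex) : center B beta (val z) = val z.
Proof. by case/andP: (valP z) => _ /eqP. Qed.

Definition vertex_ob (z : vertex) : K :=
  exist _ (cell_of A b (lsubmx (val z)), cell_of A b (rsubmx (val z)))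
    (disjoint_support_supp (vertexU z)).

Lemma vertex_eq (y z : vertex) : same_face B beta (val y) (val z) -> y = z.
Proof.
move=> yz; apply: val_inj; rewrite -vertex_center -[RHS]vertex_center.
exact: (center_eq Bfree).
Qed.

Fact vertex_translate_subproof (v : 'rV[int]_(d + d)) (z : vertex) :
  U (val z + 'i v) && (center B beta (val z + 'i v) == val z + 'i v).
Proof.
rewrite (center_translate _ Bfree) vertex_center eqxx andbT.
by rewrite disjoint_support_translate vertexU.
Qed.

Definition vertex_translate v (z : vertex) : vertex :=
  exist _ (val z + 'i v) (vertex_translate_subproof v z).

Lemma vertex_ob_eqP y z :
  vertex_ob y = vertex_ob z <-> exists v, z = vertex_translate v y.
Proof.
split=> [e|[v ->]].
  have /cell_of_eqP[v zy] := congr1 (fun x : K => (sval x).1) e.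
  have /cell_of_eqP[w zy'] := congr1 (fun x : K => (sval x).2) e.
  exists (row_mx v w); apply: vertex_eq.
  by rewrite same_face_square !sub_translate row_mxKl row_mxKr zy zy'.
apply: eq_exist; congr (_, _); apply/cell_of_eqP.
  by exists (lsubmx v); rewrite /= sub_translate same_face_refl.
by exists (rsubmx v); rewrite /= sub_translate same_face_refl.
Qed.

Lemma vertex_ob_surj (x : K) : exists z, x = vertex_ob z.
Proof.
case: x => [[F G]] /= FG.
have [x xE] := cell_of_surj F; have [y yE] := cell_of_surj G; subst F G.
have Uxy : U (row_mx x y).
  apply/forallP => j; rewrite row_mxKl row_mxKr; apply/negP => /andP[xj yj].
  by move/suppP: FG; apply; exists j.
have cs := same_face_center B beta (row_mx x y).
set c := center B beta (row_mx x y) in cs.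
have Uc : U c && (center B beta c == c).
  by rewrite (disjoint_support_same cs) Uxy (centerK _ Bfree) eqxx.
exists (exist _ c Uc); apply: eq_exist.
move: cs; rewrite same_face_square row_mxKl row_mxKr => /andP[cl cr].
by congr (_, _); apply/cell_of_eqP; exists 0; rewrite map_mx0 addr0.
Qed.

Local Notation "y <=f z" := (face_le B beta (val y) (val z)) (at level 70).
Local Notation "y <f z" := (face_lt B beta (val y) (val z)) (at level 70).

Definition vertex_hom (z y : vertex) (yz : y <=f z) :
    @Defs.hom K (vertex_ob z) (vertex_ob y) :=
  let yz' := andP (etrans (esym (face_le_square _ _)) yz) in
  (face_morphism (let: conj l _ := yz' in l),
   face_morphism (let: conj _ r := yz' in r)).

Definition vertex_arrow (z y : vertex) : arrow K :=
  match @idP (y <=f z) with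
  | ReflectT yz => Arrow (vertex_hom yz)
  | ReflectF _ => Arrow (idm (vertex_ob z))
  end.

(* Non-dependent data through which arrows are compared. *)
Definition arrow_data (a : arrow K) :=
  (source a, target a, sval (projT2 (projT2 a)).1, sval (projT2 (projT2 a)).2).

Lemma arrow_data_inj : injective arrow_data.
Proof.
move=> [x [y [f f']]] [x' [y' [g g']]]; rewrite /arrow_data /source /target /=.
move=> [ex ey]; subst x' y' => fg fg'.
by rewrite (cell_morphism_eq fg) (cell_morphism_eq fg').
Qed.

Definition face_pair (y z : V) := pair_orbit (face_of A b y) (face_of A b z).

Lemma vertex_arrow_data z y : y <=f z -> arrow_data (vertex_arrow z y) =
  (vertex_ob z, vertex_ob y, face_pair (lsubmx (val y)) (lsubmx (val z)),
   face_pair (rsubmx (val y)) (rsubmx (val z))).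
Proof. by rewrite /vertex_arrow; case: {-}_ / idP. Qed.

Lemma source_vertex_arrow z y : source (vertex_arrow z y) = vertex_ob z.
Proof. by rewrite /vertex_arrow; case: {-}_ / idP. Qed.

Lemma target_vertex_arrow z y :
  y <=f z -> target (vertex_arrow z y) = vertex_ob y.
Proof. by move/vertex_arrow_data; case. Qed.

Lemma vertex_arrow_id z y : y <f z -> ~ is_identity (vertex_arrow z y).
Proof.
move=> /andP[yz nzy] [x /(congr1 arrow_data)].
rewrite vertex_arrow_data// => -[xz xy el er].
have fid (u v : V) (F : cell A b) : face_pair u v = sval (cell_id F) ->
    same_face A off u v.
  move=> e; have : face_pair u v (face_of A b u, face_of A b v).
    by exists 0 => //; rewrite !translate0.
  by rewrite e => -[_ /= /face_of_eqP].
apply: (negP nzy); suff : same_face B beta (val y) (val z) by case/andP.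
by rewrite same_face_square (fid _ _ _ el) (fid _ _ _ er).
Qed.

Lemma vertex_arrow_inj z y y' : y <=f z -> y' <=f z ->
  vertex_arrow z y = vertex_arrow z y' -> y = y'.
Proof.
move=> yz yz' /(congr1 arrow_data); rewrite !vertex_arrow_data//.
move=> e; have el := congr1 (fun q => q.1.2) e; have er := congr1 snd e.
apply: vertex_eq; rewrite same_face_square.
by rewrite (pair_orbit_inj A_rank el) (pair_orbit_inj A_rank er).
Qed.

Lemma vertex_arrow_translate v z y : y <=f z ->
  vertex_arrow (vertex_translate v z) (vertex_translate v y) = vertex_arrow z y.
Proof.
move=> yz; apply: arrow_data_inj; rewrite !vertex_arrow_data//; last first.
  by rewrite /= face_le_translate.
have obE x : vertex_ob (vertex_translate v x) = vertex_ob x.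
  by apply/esym/vertex_ob_eqP; exists v.
rewrite !obE /= !sub_translate /face_pair.
by rewrite !pair_orbit_shift.
Qed.

Lemma vertex_arrow_surj z (a : arrow K) : source a = vertex_ob z ->
  exists2 y, y <=f z & a = vertex_arrow z y.
Proof.
case: a => x [x' [f f']]; rewrite /source /= => xE; subst x.
have [l lz [lE fE]] := face_morphism_surj (F := (sval x').1) f.
have [r rz [rE fE']] := face_morphism_surj (F := (sval x').2) f'.
have [y0 y0E] := vertex_ob_surj x'.
have /cell_of_eqP[v lv] : cell_of A b (lsubmx (val y0)) = cell_of A b l.
  by rewrite -lE y0E.
have /cell_of_eqP[w rw] : cell_of A b (rsubmx (val y0)) = cell_of A b r.
  by rewrite -rE y0E.
pose y := vertex_translate (row_mx v w) y0.
have ly : same_face A off l (lsubmx (val y)) by rewrite sub_translate row_mxKl.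
have ry : same_face A off r (rsubmx (val y)) by rewrite sub_translate row_mxKr.
have yz : y <=f z.
  rewrite face_le_square; move: ly ry => /andP[_ ly] /andP[_ ry].
  by rewrite (face_le_trans ly lz) (face_le_trans ry rz).
exists y => //; apply: arrow_data_inj; rewrite vertex_arrow_data//.
rewrite /arrow_data /source /target /=.
congr (_, _, _, _).
- by rewrite y0E; apply/vertex_ob_eqP; exists (row_mx v w).
- by rewrite fE /face_pair; congr pair_orbit; exact/face_of_eqP.
- by rewrite fE' /face_pair; congr pair_orbit; exact/face_of_eqP.
Qed.

Lemma vertex_arrow_composite z y x : y <=f z -> x <=f y ->
  is_composite (vertex_arrow z y) (vertex_arrow y x) (vertex_arrow z x).
Proof.
move=> yz xy; have xz := face_le_trans xy yz.
rewrite /vertex_arrow; case: {-}_ / idP => // yz'; case: {-}_ / idP => // xy'.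
exists (vertex_ob z), (vertex_ob y), (vertex_ob x), (vertex_hom yz'), (vertex_hom xy').
split=> //; rewrite -/(vertex_arrow z x); apply: arrow_data_inj.
rewrite vertex_arrow_data//; rewrite /arrow_data /source /target.
congr (_, _, _, _).
  exact/esym/(@cell_compE _ _ _ _ _ A_rank _ _ _ (vertex_hom xy').1 (vertex_hom yz').1).
exact/esym/(@cell_compE _ _ _ _ _ A_rank _ _ _ (vertex_hom xy').2 (vertex_hom yz').2).
Qed.

Lemma is_composite_fun (a c e e' : arrow K) :
  is_composite a c e -> is_composite a c e' -> e = e'.
Proof.
have dataE x : is_composite a c x -> arrow_data x =
    (source a, target c,
     ((arrow_data a).1.2 \; (arrow_data c).1.2)%relation,
     ((arrow_data a).2 \; (arrow_data c).2)%relation).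
  move=> [s [t [u [f [g [aE cE xE]]]]]]; subst a c x.
  by rewrite /arrow_data /source /target /=.
move=> /dataE eE /dataE eE'; apply: arrow_data_inj; exact: etrans eE (esym eE').
Qed.

Definition below : rel vertex := fun z y => y <f z.

Lemma below_trans : transitive below.
Proof. by move=> y x z xy yz; exact: face_lt_trans yz xy. Qed.

Definition lift_chain z (s : seq vertex) : K * seq (arrow K) :=
  (vertex_ob z, pairmap vertex_arrow z s).

Lemma lift_chain_composable z s :
  path below z s -> composable (lift_chain z s).1 (lift_chain z s).2.
Proof.
elim: s z => // y s IHs z /= /andP[yz ys]; split.
- exact: source_vertex_arrow.
- exact: vertex_arrow_id.
- rewrite target_vertex_arrow; last exact: face_lt_le.
  exact: IHs.
Qed.

Lemma vertex_arrow_diag z : is_identity (vertex_arrow z z).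
Proof.
exists (vertex_ob z); rewrite /vertex_arrow; case: {-}_ / idP => // zz.
by rewrite (proj2 (cell_pair_category_acyclic b A_rank) _ (vertex_hom zz)).
Qed.

Lemma lift_chain_surj (c : K * seq (arrow K)) : composable c.1 c.2 ->
  exists z s, path below z s /\ c = lift_chain z s.
Proof.
case: c => x t /=; have [z ->] := vertex_ob_surj x => ct.
suff [s zs ->] : exists2 s, path below z s & t = pairmap vertex_arrow z s.
  by exists z, s.
elim: t z ct => [|a t IHt] z; first by exists [::].
move=> [az na ct]; have [y yz aE] := vertex_arrow_surj az; subst a.
have ltyz : y <f z.
  rewrite /face_lt yz; apply/negP => zy; apply: na.
  have -> : y = z by apply: vertex_eq; rewrite /same_face yz.
  exact: vertex_arrow_diag.
rewrite target_vertex_arrow// in ct; have [s ys ->] := IHt y ct.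
by exists (y :: s) => //=; rewrite ys andbT.
Qed.

Lemma lift_chain_uniq z s z' s' : path below z s -> path below z' s' ->
  lift_chain z s = lift_chain z' s' ->
  exists v, z' :: s' = [seq vertex_translate v y | y <- z :: s].
Proof.
move=> zs zs' e; have /vertex_ob_eqP[v zE] := congr1 fst e.
have /= ss := congr1 snd e; exists v; subst z'; congr (_ :: _).
elim: s z zs s' zs' ss {e} => [|y s IHs] z zs [|y' s'] zs' //= [yE ss].
have /andP[yz ys] := zs; have /andP[yz' ys'] := zs'.
have {}yE : y' = vertex_translate v y.
  apply: (@vertex_arrow_inj (vertex_translate v z)).
  - exact: face_lt_le.
  - by rewrite face_le_translate face_lt_le.
  - rewrite vertex_arrow_translate; last exact: face_lt_le.
    by rewrite yE.
by rewrite yE; congr (_ :: _); apply: (IHs y) => //; rewrite -yE.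
Qed.

Lemma chain_face_drop z s z' s' s1 x s2 : path below z s ->
  z :: s = s1 ++ x :: s2 -> z' :: s' = s1 ++ s2 ->
  chain_face (size s1) (lift_chain z s) (lift_chain z' s').
Proof.
case: s1 => [|z1 s1] zs [zE sE] /=; last case=> zE' sE'; move=> *; subst.
  rewrite /lift_chain /=; case/andP: zs => yz _.
  rewrite -(target_vertex_arrow (face_lt_le yz)); exact: Drop_first.
case: s2 zs => [|y s2] zs; rewrite /lift_chain.
  rewrite cats0 cats1 -[in X in chain_face _ X](cats1 s1) pairmap_cat /= cats1.
  by rewrite -(size_pairmap vertex_arrow z1 s1); exact: Drop_last.
rewrite !pairmap_cat /=.
rewrite -(size_pairmap vertex_arrow z1 s1); apply: Compose.
move: zs; rewrite cat_path /= => /and4P[_ h1 h2 _].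
by apply: vertex_arrow_composite; exact: face_lt_le.
Qed.

Lemma chain_face_lift i z s c : path below z s ->
  chain_face i (lift_chain z s) c ->
  exists s1 x s2 z' s', [/\ z :: s = s1 ++ x :: s2, size s1 = i,
    z' :: s' = s1 ++ s2 & c = lift_chain z' s'].
Proof.
have inv (c0 : K * seq (arrow K)) : chain_face i c0 c ->
  [\/ exists a t, [/\ i = 0%N, c0.2 = a :: t & c = (target a, t)],
      exists t a, [/\ i = (size t).+1, c0.2 = rcons t a & c = (c0.1, t)]
    | exists t a e ae t', [/\ is_composite a e ae, i = (size t).+1,
        c0.2 = t ++ [:: a, e & t'] & c = (c0.1, t ++ ae :: t')]].
  case=> [x a t|x t a|x t a e ae t' h].
  - by apply: Or31; exists a, t.
  - by apply: Or32; exists t, a.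
  - by apply: Or33; exists t, a, e, ae, t'.
move=> zs /inv[[a [t [-> + ->]]]|[t [a [-> + ->]]]
  |[t [a [e [ae [t' [h -> + ->]]]]]]] /=.
- case: s zs => // y s /= /andP[yz _] [<- <-].
  exists [::], z, (y :: s), y, s; split=> //.
  by rewrite target_vertex_arrow//; exact: face_lt_le.
- case/lastP: s zs => [|s y] zs; first by case: t.
  have -> : (lift_chain z (rcons s y)).2 =
      rcons (pairmap vertex_arrow z s) (vertex_arrow (last z s) y).
    by rewrite /lift_chain -!cats1 pairmap_cat.
  move=> /rcons_inj[<- _].
  exists (z :: s), y, [::], z, s; split=> //=.
  + by rewrite cats1.
  + by rewrite size_pairmap.
  + by rewrite cats0.
- rewrite /lift_chain /= => sE; have sz : (size t < size s)%N.
    by rewrite -(size_pairmap vertex_arrow z) sE size_cat /=; lia.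
  have : pairmap vertex_arrow z (take (size t) s ++ drop (size t) s) =
      t ++ [:: a, e & t'].
    by rewrite cat_take_drop.
  rewrite pairmap_cat => e2.
  have st : size (pairmap vertex_arrow z (take (size t) s)) = size t.
    by rewrite size_pairmap size_take sz.
  have tE := congr1 (take (size t)) e2; have dE := congr1 (drop (size t)) e2.
  rewrite !take_size_cat// in tE; rewrite !drop_size_cat// in dE.
  move: zs; rewrite -{1}(cat_take_drop (size t) s).
  case: (drop (size t) s) dE (cat_take_drop (size t) s) => [|y [|x s2]]//=.
  move=> [aE eE t'E] cE.
  rewrite cat_path /= => /and4P[_ yl xy _].
  exists (z :: take (size t) s), y, (x :: s2), z, (take (size t) s ++ x :: s2).
  split=> //=; first by rewrite cE.
    by rewrite size_take sz.
  rewrite /lift_chain pairmap_cat /= tE t'E; congr (_, _ ++ _ :: _).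
  apply: is_composite_fun h _; rewrite -aE -eE.
  by apply: vertex_arrow_composite; exact: face_lt_le.
Qed.

(* Junk value: the vertex [z] when [z :: s] is not decreasing. *)
Definition lifted_chain z s : chain K :=
  match pselect (composable (lift_chain z s).1 (lift_chain z s).2) with
  | left c => exist _ (lift_chain z s) c
  | right _ => exist (fun xs => composable xs.1 xs.2) (vertex_ob z, [::]) I
  end.

Lemma lifted_chainE z s : path below z s ->
  sval (lifted_chain z s) = lift_chain z s.
Proof.
by move=> /lift_chain_composable zs; rewrite /lifted_chain; case: pselect.
Qed.

Lemma dim_lifted_chain z s : path below z s -> Defs.dim (lifted_chain z s) = size s.
Proof. by move=> zs; rewrite /Defs.dim lifted_chainE// size_pairmap. Qed.

Definition lifted_point z s (w : W -> R) : realization R K :=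
  weighted_point (lifted_chain z s) (nth 0 [seq w (val y) | y <- z :: s]).

Lemma nth_bump (T : Type) (t0 x : T) (s1 s2 : seq T) k :
  nth t0 (s1 ++ x :: s2) (bump (size s1) k) = nth t0 (s1 ++ s2) k.
Proof.
rewrite !nth_cat /bump; have [sk|sk] := leqP (size s1) k.
  by rewrite add1n ltnNge (leqW sk) /= subSn.
by rewrite add0n sk.
Qed.

Lemma sum_norm_lifted z s (w : W -> R) : path below z s ->
  \sum_(k < (Defs.dim (lifted_chain z s)).+1) `|nth 0 [seq w (val y) | y <- z :: s] k| =
  \sum_(y <- z :: s) `|w (val y)|.
Proof.
move=> zs; rewrite dim_lifted_chain// (big_nth z) big_mkord.
by apply: eq_bigr => k _; rewrite (nth_map z).
Qed.

Lemma lifted_point_drop z s z' s' s1 x s2 (w : W -> R) : path below z s ->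
  z :: s = s1 ++ x :: s2 -> z' :: s' = s1 ++ s2 -> w (val x) = 0 ->
  \sum_(y <- z :: s) `|w (val y)| != 0 ->
  lifted_point z s w = lifted_point z' s' w.
Proof.
move=> zs sE s'E wx w0.
have zs' : path below z' s'.
  have : sorted below (z' :: s').
    rewrite s'E; apply: (subseq_sorted below_trans (s2 := z :: s)) => //.
    by rewrite sE cat_subseq// subseq_cons.
  by [].
rewrite /lifted_point (@weighted_point_face _ _ (size s1) _ (lifted_chain z' s')).
- congr weighted_point; apply/funext => k.
  by rewrite sE s'E !map_cat /= -(size_map (fun y => w (val y)) s1) nth_bump.
- by rewrite !lifted_chainE//; exact: chain_face_drop sE s'E.
- by rewrite sE map_cat nth_cat size_map ltnn subnn.
- by rewrite sum_norm_lifted.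
Qed.

Lemma lifted_point_filter z s z' s' (w : W -> R) : path below z s ->
  z' :: s' = [seq y <- z :: s | w (val y) != 0] ->
  lifted_point z s w = lifted_point z' s' w.
Proof.
have [m] := ubnP (size s); elim: m z s => // m IHm z s sm zs fE.
have w0 : \sum_(y <- z :: s) `|w (val y)| != 0.
  have : z' \in [seq y <- z :: s | w (val y) != 0] by rewrite -fE mem_head.
  rewrite mem_filter => /andP[wz zzs]; rewrite psumr_neq0//.
  by apply/hasP; exists z' => //=; rewrite normr_gt0.
have [aw|] := boolP (all (fun y => w (val y) != 0) (z :: s)).
  by move: fE; rewrite (all_filterP aw) => -[-> ->].
case/allPn => x xs; rewrite negbK => /eqP wx.
have [s1 [s2 sE]] : exists s1 s2, z :: s = s1 ++ x :: s2.
  by case/splitPr: xs => s1 s2; exists s1, s2.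
have fE' : z' :: s' = [seq y <- s1 ++ s2 | w (val y) != 0].
  by rewrite fE sE !filter_cat /= wx eqxx.
case s12 : (s1 ++ s2) fE' => [//|z1 t] fE'.
rewrite (lifted_point_drop zs sE (esym s12) wx w0); apply: IHm => //.
  have := congr1 size sE; rewrite size_cat /= addnS -size_cat s12 /= => -[e].
  by move: sm; rewrite e ltnS.
have : sorted below (z1 :: t).
  rewrite -s12; apply: (subseq_sorted below_trans (s2 := z :: s)) => //.
  by rewrite sE cat_subseq// subseq_cons.
by [].
Qed.

Local Notation carr := (carrier beta Bfree).
Local Notation coo := (coordinate beta Bfree).

Definition vertices (s : seq W) : seq vertex := pmap insub s.

Lemma val_vertices s : [seq val y | y <- vertices s] =
  [seq y <- s | U y && (center B beta y == y)].
Proof.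
rewrite /vertices; elim: s => //= y s IHs; case: insubP => [x Px xy|/negbTE ->//].
by rewrite /= xy Px IHs.
Qed.

Lemma val_vertices_flag s : flag B beta s ->
  [seq val y | y <- vertices s] = [seq y <- s | U y].
Proof.
case/andP => _ /allP cs; rewrite val_vertices; apply: eq_in_filter => y /cs ->.
by rewrite andbT.
Qed.

Lemma vertices_below s y t : flag B beta s -> vertices s = y :: t -> path below y t.
Proof.
move=> F sE; have : sorted below (y :: t); last by [].
rewrite -sE; have /andP[+ _] := flag_filter (fun y => U y && (center B beta y == y)) F.
by rewrite -val_vertices sorted_map.
Qed.

Lemma vertices_filter (P : pred W) s :
  vertices [seq y <- s | P y] = [seq y <- vertices s | P (val y)].
Proof.
rewrite /vertices; elim: s => //= y s IHs; case: ifP => Py /=.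
  by case: insubP => [x Px xy|_] /=; rewrite IHs// xy Py.
by case: insubP => [x Px xy|_] /=; rewrite IHs// xy Py.
Qed.

Lemma big_vertices (V' : nmodType) s (f : W -> V') : flag B beta s ->
  \sum_(y <- vertices s) f (val y) = \sum_(y <- s | U y) f y.
Proof. by move=> F; rewrite -[RHS]big_filter -val_vertices_flag// big_map. Qed.

Lemma vertices_carrier z : U z ->
  exists y t, vertices (carr z) = y :: t /\ val y = center B beta z.
Proof.
move=> Uz; rewrite carrierE /vertices /=.
have Uc : U (center B beta z) && (center B beta (center B beta z) == center B beta z).
  by rewrite (disjoint_support_same (same_face_center _ _ _)) Uz centerK ?eqxx//;
    exact: Bfree.
by rewrite insubT /=; do 2 eexists.
Qed.

Variable p0 : realization R K.

Definition flag_retraction (s : seq W) (w : W -> R) : realization R K :=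
  if vertices s is y :: t then lifted_point y t w else p0.

Definition flag_push (s : seq W) (w : W -> R) : W :=
  (\sum_(y <- s | U y) w y)^-1 *: \sum_(y <- s | U y) w y *: y.

Definition retraction (z : W) := flag_retraction (carr z) (coo z).
Definition push (z : W) := flag_push (carr z) (coo z).

Lemma barycentric_vertices z s w : barycentric B beta z s w -> U z ->
  exists y t, [/\ vertices s = y :: t, path below y t
    & 0 < \sum_(x <- y :: t) `|w (val x)|].
Proof.
move=> zsw Uz; have [cE wE] := barycentric_carrier Bfree zsw.
have [y0 [t0 [vE y0z]]] := vertices_carrier Uz.
have y0s : y0 \in vertices s.
  have : y0 \in vertices (carr z) by rewrite vE mem_head.
  by rewrite -cE vertices_filter mem_filter => /andP[].
have F : flag B beta s by case: zsw.
case sE : (vertices s) y0s => [//|y t] y0s.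
exists y, t; split=> //; first exact: vertices_below sE.
rewrite lt_def sumr_ge0// andbT psumr_neq0//; apply/hasP; exists y0 => //=.
rewrite normr_gt0 gt_eqF//.
have : y0 \in vertices (carr z) by rewrite vE mem_head.
by rewrite -cE vertices_filter mem_filter => /andP[].
Qed.

Lemma retraction_bary z s w : barycentric B beta z s w -> U z ->
  retraction z = flag_retraction s w.
Proof.
move=> zsw Uz; have [cE wE] := barycentric_carrier Bfree zsw.
have [y [t [sE yt _]]] := barycentric_vertices zsw Uz.
have [y0 [t0 [vE _]]] := vertices_carrier Uz.
rewrite /retraction /flag_retraction sE vE.
rewrite (@lifted_point_filter y t y0 t0)//.
  rewrite /lifted_point; congr weighted_point; congr nth; apply/eq_in_map => x xt.
  apply/esym/wE; have : val x \in [seq val x | x <- vertices (carr z)].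
    by rewrite vE map_f.
  by rewrite val_vertices mem_filter => /andP[].
rewrite -vE -cE vertices_filter -sE; apply: eq_in_filter => x xs.
have [_ w0 _ _] := zsw; have : val x \in s.
  have : val x \in [seq val x | x <- vertices s] by rewrite map_f.
  by rewrite val_vertices mem_filter => /andP[].
by move=> /w0 wx; rewrite lt_def wx andbT.
Qed.

Lemma push_bary z s w : barycentric B beta z s w -> push z = flag_push s w.
Proof.
move=> zsw; have [cE wE] := barycentric_carrier Bfree zsw.
have [_ w0 _ _] := zsw.
have sumE (V' : nmodType) (f : W -> V') : (forall y, w y = 0 -> f y = 0) ->
    \sum_(y <- s | U y) f y = \sum_(y <- carr z | U y) f y.
  move=> f0; rewrite -cE big_filter_cond (bigID (fun y => 0 < w y))/=.
  rewrite [X in _ + X]big_seq_cond [X in _ + X]big1 ?addr0.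
    by apply: eq_bigl => y; rewrite andbC.
  move=> y /andP[ys /andP[_ wy]]; apply: f0; apply/eqP; move: wy.
  by rewrite lt_def w0// andbT negbK.
rewrite /push /flag_push !sumE//; last by move=> y ->; rewrite scale0r.
congr (_^-1 *: _); rewrite big_seq_cond [RHS]big_seq_cond.
  by apply: eq_bigr => y /andP[yz _]; rewrite wE.
by apply: eq_bigr => y /andP[yz _]; rewrite wE.
Qed.

Lemma push_same_face z : U z -> same_face B beta (push z) z.
Proof.
move=> Uz; apply: same_face_trans (same_face_center B beta z).
have [F c0 _ _] := carrierP beta Bfree z.
rewrite /push /flag_push -!(big_filter _ U).
have Uc : U (center B beta z).
  by rewrite (disjoint_support_same (same_face_center B beta z)).
have fE : [seq y <- carr z | U y] =
    center B beta z :: [seq y <- behead (carr z) | U y].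
  by rewrite carrierE /= Uc.
have mem y : y \in [seq y <- carr z | U y] -> y \in carr z.
  by rewrite mem_filter => /andP[].
rewrite fE in mem *; apply: same_face_comb.
- move=> y ys; apply/face_lt_le; apply: (@flag_le _ _ _ _ _ _ (behead (carr z))).
    by rewrite -carrierE.
  by move: ys; rewrite mem_filter => /andP[].
- by move=> y /mem; exact: c0.
- by apply: coordinate_gt0; apply: mem; rewrite mem_head.
Qed.

Lemma carrier_sum_gt0 z : U z -> 0 < \sum_(y <- carr z | U y) coo z y.
Proof.
move=> Uz; have [F c0 _ _] := carrierP beta Bfree z.
rewrite lt_def; apply/andP; split; last first.
  by rewrite big_seq_cond sumr_ge0// => y /andP[/c0].
rewrite big_seq_cond psumr_neq0; last by move=> y /andP[/c0].
apply/hasP; exists (center B beta z); first by rewrite carrierE mem_head.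
rewrite {1}carrierE mem_head /=.
rewrite (disjoint_support_same (same_face_center B beta z)) Uz /=.
by apply: coordinate_gt0; rewrite carrierE mem_head.
Qed.

Lemma push_translate z v : U z -> push (z + 'i v) = push z + 'i v.
Proof.
move=> Uz; have [cE wE] := carrier_translate beta Bfree z v.
have tot := carrier_sum_gt0 Uz.
rewrite /push /flag_push cE !big_map.
rewrite (eq_bigl U) => [|y]; last exact: disjoint_support_translate.
rewrite [in X in _ *: X](eq_bigl U) => [|y]; last exact: disjoint_support_translate.
have -> : \sum_(y <- carr z | U y) coo (z + 'i v) (y + 'i v) =
          \sum_(y <- carr z | U y) coo z y.
  rewrite big_seq_cond [RHS]big_seq_cond.
  by apply: eq_bigr => y /andP[yz _]; rewrite wE.
have -> : \sum_(y <- carr z | U y) coo (z + 'i v) (y + 'i v) *: (y + 'i v) =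
    \sum_(y <- carr z | U y) coo z y *: y + (\sum_(y <- carr z | U y) coo z y) *: 'i v.
  rewrite scaler_suml -big_split big_seq_cond [RHS]big_seq_cond.
  by apply: eq_bigr => y /andP[yz _]; rewrite wE// scalerDr.
by rewrite scalerDr scalerA mulVf ?scale1r// gt_eqF.
Qed.

Lemma vertices_translate s v :
  vertices [seq y + 'i v | y <- s] = [seq vertex_translate v y | y <- vertices s].
Proof.
apply: (inj_map val_inj); rewrite val_vertices filter_map -map_comp.
rewrite [RHS](_ : _ = [seq y + 'i v | y <- [seq val y | y <- vertices s]]).
  rewrite val_vertices; congr map.
  apply: eq_filter => y /=; rewrite disjoint_support_translate.
  by rewrite (center_translate _ Bfree) (inj_eq (addIr _)).
by rewrite -[RHS]map_comp.
Qed.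

Lemma lift_chain_translate v z s : path below z s ->
  lift_chain (vertex_translate v z) [seq vertex_translate v y | y <- s] =
  lift_chain z s.
Proof.
move=> zs; rewrite /lift_chain; congr (_, _).
  by apply/esym/vertex_ob_eqP; exists v.
elim: s z zs => //= y s IHs z /andP[yz ys].
by rewrite IHs// vertex_arrow_translate//; exact: face_lt_le.
Qed.

Lemma lifted_chain_translate v z s : path below z s ->
  lifted_chain (vertex_translate v z) [seq vertex_translate v y | y <- s] =
  lifted_chain z s.
Proof.
move=> zs.
have zs' : path below (vertex_translate v z) [seq vertex_translate v y | y <- s].
  rewrite path_map; apply: sub_path zs => x y.
  by rewrite /below /= /face_lt !face_le_translate.
have := lift_chain_translate v zs; rewrite -!lifted_chainE//.
case: (lifted_chain _ _) (lifted_chain _ _) => [c Pc] [c' Pc'] /= cc.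
exact: eq_exist.
Qed.

Lemma retraction_translate z v : U z -> retraction (z + 'i v) = retraction z.
Proof.
move=> Uz; have [cE wE] := carrier_translate beta Bfree z v.
have [y [t [vE _]]] := vertices_carrier Uz.
have [F _ _ _] := carrierP beta Bfree z.
rewrite /retraction /flag_retraction cE vertices_translate vE /=.
rewrite /lifted_point lifted_chain_translate; last exact: vertices_below vE.
congr weighted_point; congr nth.
rewrite -[X in map _ X = _]/(map (vertex_translate v) (y :: t)) -map_comp.
apply/eq_in_map => x xt /=; apply: wE.
have : val x \in [seq val x | x <- vertices (carr z)].
  by rewrite vE map_f.
by rewrite val_vertices mem_filter => /andP[].
Qed.

Definition flag_weight (s : seq W) (t : 'rV[R]_(size s)) (y : W) : R :=
  oapp (t 0) 0 (insub (index y s)).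

Lemma flag_weight_nth (s : seq W) (t : 'rV[R]_(size s)) (k : 'I_(size s)) :
  uniq s -> flag_weight t s`_k = t 0 k.
Proof.
move=> us; rewrite /flag_weight index_uniq// insubT //= => kp.
by congr (t 0 _); apply: val_inj.
Qed.

Lemma flag_weight_barycentric s (t : 'rV[R]_(size s)) : flag B beta s ->
  simplex_points t -> barycentric B beta (flag_point t) s (flag_weight t).
Proof.
move=> F [t0 t1]; have us := flag_uniq F; split=> //.
- by move=> y _; rewrite /flag_weight; case: insubP => //= k.
- by rewrite -t1 (big_nth 0) big_mkord; apply: eq_bigr => k _; rewrite flag_weight_nth.
- by rewrite (big_nth 0) big_mkord; apply: eq_bigr => k _; rewrite flag_weight_nth.
Qed.

Lemma flag_weight_continuous s y :
  continuous (fun t : 'rV[R]_(size s) => flag_weight t y).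
Proof.
rewrite /flag_weight; case: insub => [k|] /=; last exact: cst_continuous.
exact: coord_continuous.
Qed.

Lemma continuous_barycentric (Y : topologicalType) (f : W -> Y)
    (g : seq W -> (W -> R) -> Y) (z0 : W) : U z0 ->
  (forall z s w, barycentric B beta z s w -> U z -> f z = g s w) ->
  (forall s w (T : Type) (F : set_system T) (w_ : T -> W -> R), Filter F ->
     barycentric B beta z0 s w -> (forall y, w_ t y @[t --> F] --> w y) ->
     g s (w_ t) @[t --> F] --> g s w) ->
  {for z0, continuous f}.
Proof.
move=> Uz0 fg gc; apply: (continuous_flagwise Bfree) => s t F tS tz.
have tb := flag_weight_barycentric F tS; rewrite tz in tb.
rewrite (fg _ _ _ tb Uz0).
pose G := within (@simplex_points R (size s)) (nbhs t).
have FG : Filter G by exact: within_filter.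
have wc y : flag_weight t' y @[t' --> G] --> flag_weight t y.
  move=> P Pt; have Pn := @flag_weight_continuous s y t P Pt.
  by apply: (@filterS _ (nbhs t) _ _ _ _ Pn) => u Pu _.
have Un : \forall t' \near G, U (flag_point t').
  have cz : center B beta z0 \in s /\ 0 < flag_weight t (center B beta z0).
    have [cE _] := barycentric_carrier Bfree tb.
    have : center B beta z0 \in carr z0 by rewrite carrierE mem_head.
    by rewrite -cE mem_filter => /andP[].
  have pos' : \forall t' \near G, 0 < flag_weight t' (center B beta z0).
    exact: (wc _ [set x | 0 < x] (lt_nbhsr cz.2)).
  have sG : \forall t' \near G, simplex_points t' by exact: withinT.
  apply: filterS2 pos' sG => t' pt St'.
  have [cE _] := barycentric_carrier Bfree (flag_weight_barycentric F St').
  have : center B beta z0 \in carr (flag_point t') by rewrite -cE mem_filter pt cz.1.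
  move=> /carrier_face_le /disjoint_support_face; apply.
  by rewrite (disjoint_support_same (same_face_center B beta z0)).
apply: (@cvg_trans _ (g s (flag_weight t') @[t' --> G])); last exact: gc.
apply: near_eq_cvg; have sG : \forall t' \near G, simplex_points t' by exact: withinT.
apply: filterS2 Un sG => t' Ut St'; apply/esym/fg => //.
exact: flag_weight_barycentric.
Qed.

Lemma retraction_continuous z : U z -> {for z, continuous retraction}.
Proof.
move=> Uz; apply: (continuous_barycentric Uz retraction_bary).
move=> s w T F w_ FF zsw wc.
have [y [t [sE yt w0]]] := barycentric_vertices zsw Uz.
rewrite /flag_retraction sE /lifted_point; apply: weighted_point_cvg.
  move=> k; have [kt|kt] := ltnP k (size (y :: t)).
    by under eq_cvg do rewrite (nth_map y)//; rewrite (nth_map y)//; exact: wc.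
  by under eq_cvg do rewrite nth_default ?size_map//; rewrite nth_default ?size_map//;
    exact: cvg_cst.
by rewrite sum_norm_lifted// gt_eqF.
Qed.

Lemma push_continuous z : U z -> {for z, continuous push}.
Proof.
move=> Uz; apply: (@continuous_barycentric _ push flag_push) => //.
  by move=> x s w /push_bary.
move=> s w T F w_ FF zsw wc; rewrite /flag_push; apply: cvgZ.
  apply: cvgV; last first.
    by apply: cvg_big => [|y _]; [exact: add_continuous | exact: wc].
  have [y [t [sE yt]]] := barycentric_vertices zsw Uz.
  have [Fs w0 _ _] := zsw; rewrite -sE (big_vertices (fun x => `|w x|))// => tot.
  rewrite gt_eqF// (lt_le_trans tot)// big_seq_cond [leRHS]big_seq_cond.
  by apply: ler_sum => x /andP[xs _]; rewrite ger0_norm ?w0.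
apply: cvg_big => [|y _]; first exact: add_continuous.
by apply: cvgZr_tmp; exact: wc.
Qed.

Lemma vertices_val (l : seq vertex) : vertices [seq val y | y <- l] = l.
Proof. by rewrite /vertices; elim: l => //= y l ->; rewrite valK. Qed.

Lemma lifted_barycentric z s (w : W -> R) : path below z s ->
  {in z :: s, forall y, 0 <= w (val y)} -> \sum_(y <- z :: s) w (val y) = 1 ->
  let x := \sum_(y <- z :: s) w (val y) *: val y in
  [/\ U x & retraction x = lifted_point z s w].
Proof.
move=> zs w0 w1 x.
have xb : barycentric B beta x [seq val y | y <- z :: s] w.
  split; [|by move=> _ /mapP[y ys ->]; exact: w0|by rewrite big_map|by rewrite big_map].
  apply/andP; split; first by rewrite sorted_map.
  by apply/allP => _ /mapP[y _ ->]; rewrite vertex_center.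
have Ux : U x.
  have [y ys wy] : exists2 y, y \in z :: s & 0 < w (val y).
    apply: contrapT => nw; have : \sum_(y <- z :: s) w (val y) = 0.
      rewrite big_seq big1// => y ys; apply/eqP; rewrite eq_le w0// andbT leNgt.
      by apply/negP => wy; apply: nw; exists y.
    by rewrite w1 => /eqP; rewrite oner_eq0.
  have [cE _] := barycentric_carrier Bfree xb.
  have : val y \in carr x by rewrite -cE mem_filter wy map_f.
  by move=> /carrier_face_le /disjoint_support_face; apply; exact: vertexU.
split=> //; rewrite (retraction_bary xb Ux) /flag_retraction vertices_val.
by [].
Qed.

Definition chain_lift (c : chain K) : vertex * seq vertex :=
  let e := cid (lift_chain_surj (svalP c)) in (projT1 e, projT1 (cid (projT2 e))).

Arguments chain_lift : simpl never.

Lemma chain_liftP c : path below (chain_lift c).1 (chain_lift c).2 /\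
  sval c = lift_chain (chain_lift c).1 (chain_lift c).2.
Proof. exact: (projT2 (cid (projT2 (cid (lift_chain_surj (svalP c)))))). Qed.

Definition affine_point (p : simplices R K) (z : vertex) (s : seq vertex) : W :=
  \sum_(k < (size s).+1) Defs.coord p k *: val (nth z (z :: s) k).

Definition simplex_lift (p : simplices R K) : W :=
  affine_point p (chain_lift (projT1 p)).1 (chain_lift (projT1 p)).2.

Lemma coord_sum1 (p : simplices R K) m : Defs.dim (projT1 p) = m ->
  \sum_(k < m.+1) Defs.coord p k = 1.
Proof.
case: p => c [t tS] /= <-; have [t0 t1] := set_mem tS; rewrite -[RHS]t1.
apply: eq_bigr => k _; rewrite /Defs.coord /= insubT //= => ?.
by congr (t 0 _); apply: val_inj.
Qed.

Lemma coord_ge0 (p : simplices R K) k : 0 <= Defs.coord p k.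
Proof.
case: p => c [t tS]; have [t0 t1] := set_mem tS.
by rewrite /Defs.coord /=; case: insubP => //= i _ _; exact: t0.
Qed.

Lemma dim_lift (c : chain K) z s : sval c = lift_chain z s -> Defs.dim c = size s.
Proof. by rewrite /Defs.dim => ->; rewrite size_pairmap. Qed.

Lemma affine_point_lift p z s : path below z s ->
  sval (projT1 p) = lift_chain z s ->
  exists v, affine_point p z s = simplex_lift p + 'i v.
Proof.
move=> zs pE; rewrite /simplex_lift; have [zs' cE] := chain_liftP (projT1 p).
move: (chain_lift _).1 (chain_lift _).2 zs' cE => z' s' zs' cE.
have [v vE] : exists v, z :: s = [seq vertex_translate v y | y <- z' :: s'].
  by apply: lift_chain_uniq => //; rewrite -cE.
exists v; rewrite /affine_point.
have -> : size s = size s' by have := congr1 size vE; rewrite size_map /= => -[].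
have c1 := coord_sum1 (dim_lift cE).
have -> : 'i v = (\sum_(k < (size s').+1) Defs.coord p k) *: ('i v : W).
  by rewrite c1 scale1r.
rewrite scaler_suml -big_split; apply: eq_bigr => k _.
by rewrite vE (nth_map z')//= scalerDr.
Qed.

Lemma glued_lift p q : glued p q -> exists v, simplex_lift q = simplex_lift p + 'i v.
Proof.
case=> i [pq pi0 pk]; have [zs pE] := chain_liftP (projT1 p).
rewrite pE in pq.
have [s1 [x [s2 [z' [s' [sE s1E s'E qE]]]]]] := chain_face_lift zs pq.
set z := (chain_lift (projT1 p)).1 in zs sE pE.
set s := (chain_lift (projT1 p)).2 in zs sE pE.
have zs' : path below z' s'.
  have : sorted below (z' :: s').
    rewrite s'E; apply: (subseq_sorted below_trans (s2 := z :: s)) => //.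
    by rewrite sE cat_subseq// subseq_cons.
  by [].
have [v vE] := affine_point_lift zs' qE.
have aE : affine_point p z s = affine_point q z' s'.
  have ss : size s = (size s').+1.
    have := congr1 size sE; rewrite size_cat /= addnS -size_cat -s'E /= => -[].
    by [].
  rewrite /affine_point ss.
  have i1 : (i < (size s').+2)%N.
    have := congr1 size s'E; rewrite size_cat s1E /= => ->; lia.
  rewrite (bigD1_ord (Ordinal i1))//= pi0 scale0r add0r.
  apply: eq_bigr => k _; rewrite pk; congr (_ *: val _).
  rewrite sE -s1E nth_bump -s'E; exact: set_nth_default.
exists (- v); rewrite map_mxN; apply/esym/eqP; rewrite subr_eq -vE -aE.
by apply/eqP.
Qed.

Lemma simplex_liftP p : U (simplex_lift p) /\
  retraction (simplex_lift p) = \pi_(realization R K)%qT p.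
Proof.
have [zs pE] := chain_liftP (projT1 p); rewrite /simplex_lift.
set z := (chain_lift _).1 in zs pE *; set s := (chain_lift _).2 in zs pE *.
pose w (x : W) : R := Defs.coord p (index x [seq val y | y <- z :: s]).
have us : uniq [seq val y | y <- z :: s].
  rewrite (map_inj_uniq val_inj).
  apply: (@sorted_uniq _ below) => //; first exact: below_trans.
  by move=> x; exact: above_irr.
have wE k : (k < (size s).+1)%N -> w (val (nth z (z :: s) k)) = Defs.coord p k.
  move=> ks; rewrite /w -(nth_map z 0)// index_uniq// size_map//.
have aE : affine_point p z s = \sum_(y <- z :: s) w (val y) *: val y.
  rewrite (big_nth z) big_mkord; apply: eq_bigr => k _; by rewrite wE.
rewrite aE; have [||Ua ->] := @lifted_barycentric z s w zs.
- by move=> y _; exact: coord_ge0.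
- rewrite (big_nth z) big_mkord -[RHS](@coord_sum1 p (size s)); last exact: dim_lift pE.
  by apply: eq_bigr => k _; rewrite wE.
split=> //; rewrite weighted_point_coord /lifted_point.
have -> : lifted_chain z s = projT1 p.
  have := lifted_chainE zs; rewrite -pE.
  by case: (lifted_chain _ _) (projT1 p) => [c Pc] [c' Pc'] /= cc; exact: eq_exist.
congr weighted_point; apply/funext => k.
have [ks|ks] := ltnP k (size s).+1; first by rewrite (nth_map z)//; exact: wE.
rewrite nth_default ?size_map// /Defs.coord; case: insubP => //= i kd.
by exfalso; move: kd; rewrite (dim_lift pE) ltnNge ks.
Qed.

Lemma affine_point_continuous (c : chain K) z s :
  continuous (fun t : simplex_of R c =>
    affine_point (existT (fun c => simplex_of R c : Type) c t) z s).
Proof.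
apply: continuous_big => [|k _ t]; first exact: add_continuous.
apply: (@continuousZr_tmp R W (simplex_of R c)
  (fun t => Defs.coord (existT (fun c => simplex_of R c : Type) c t) k)).
rewrite /Defs.coord /=; case: insub => [i|]; last exact: cst_continuous.
apply: (@continuous_comp _ _ _ set_val (fun x : 'rV_ _ => x 0 i)).
  exact: initial_continuous.
exact: coord_continuous.
Qed.

Lemma simplex_lift_continuous (c : chain K) :
  continuous (fun t : simplex_of R c =>
    simplex_lift (existT (fun c => simplex_of R c : Type) c t)).
Proof. exact: (@affine_point_continuous c (chain_lift c).1 (chain_lift c).2). Qed.

Lemma push_lift z : U z -> exists p v,
  retraction z = \pi_(realization R K)%qT p /\ push z = simplex_lift p + 'i v.
Proof.
move=> Uz; have zc := carrierP beta Bfree z; have [F c0 _ _] := zc.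
have [y [t [vE yt w0]]] := barycentric_vertices zc Uz.
pose p := weighted_simplex (lifted_chain y t) (nth 0 [seq coo z (val x) | x <- y :: t]).
have [v vP] := affine_point_lift yt (lifted_chainE yt : sval (projT1 p) = _).
exists p, v; split; first by rewrite /retraction /flag_retraction vE.
have cE x : x \in y :: t -> `|coo z (val x)| = coo z (val x).
  move=> xt; rewrite ger0_norm// c0//.
  have : val x \in [seq val x | x <- vertices (carr z)] by rewrite vE map_f.
  by rewrite val_vertices mem_filter => /andP[].
rewrite -vP /push /flag_push -!(big_vertices _ F) vE.
rewrite [X in X^-1 *: _](eq_big_seq (fun x => `|coo z (val x)|)) => [|x /cE //].
have s0 := sum_norm_lifted (coo z) yt.
rewrite /affine_point scaler_sumr (big_nth y) big_mkord; apply: eq_bigr => k _.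
rewrite scalerA coord_weighted; last by rewrite s0 gt_eqF.
rewrite s0 dim_lifted_chain// ltn_ord mulrC (nth_map y)//; congr (_ * _ *: _).
by rewrite cE// mem_nth.
Qed.

Lemma disjoint_support_near z : U z -> \forall y \near z, U y.
Proof.
have posc (h : W -> V) j : continuous h -> continuous (fun z => pos A off (h z) j).
  move=> hc x; apply: (@continuous_comp W V R h (fun x => pos A off x j)).
    exact: hc.
  exact: pos_continuous.
have near_nint (f : W -> R) x : continuous f -> f x \isn't a Num.int ->
    \forall y \near x, f y \isn't a Num.int.
  move=> fc fx; set m := Num.floor (f x).
  have /andP[l1 l2] : m%:~R <= f x < (m + 1)%:~R by exact: floor_itv.
  have {}l1 : m%:~R < f x by rewrite lt_neqAle l1 andbT -intrEfloor.
  apply: (@filterS2 _ (nbhs x) _ _ _ _ _ (fc x [set y | m%:~R < y] (lt_nbhsr l1))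
    (fc x [set y | y < (m + 1)%:~R] (lt_nbhsl l2))) => y /= y1 y2.
  apply/negP => /intrP[k kE]; move: y1 y2; rewrite kE !ltr_int; lia.
have lc : continuous (@lsubmx R 1 d d).
  move=> x; apply: (@cvg_row R d W (nbhs x)) => k.
  rewrite (_ : (fun _ => _) = (fun y : W => y 0 (lshift d k))) ?mxE.
    exact: coord_continuous.
  by apply/funext => y; rewrite mxE.
have rc : continuous (@rsubmx R 1 d d).
  move=> x; apply: (@cvg_row R d W (nbhs x)) => k.
  rewrite (_ : (fun _ => _) = (fun y : W => y 0 (rshift d k))) ?mxE.
    exact: coord_continuous.
  by apply/funext => y; rewrite mxE.
move=> /forallP Uz.
have : \forall y \near z, forall j, ~~ ((pos A off (lsubmx y) j \is a Num.int) &&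
    (pos A off (rsubmx y) j \is a Num.int)).
  apply: (@filter_forall _ _ _ (nbhs z)) => j.
  have := Uz j; rewrite negb_and => /orP[nl|nr].
    apply: (@filterS _ (nbhs z) _ _ _ _ (near_nint _ z (posc _ j lc) nl)) => y ny.
    by rewrite negb_and ny.
  apply: (@filterS _ (nbhs z) _ _ _ _ (near_nint _ z (posc _ j rc) nr)) => y ny.
  by rewrite negb_and ny orbT.
by apply: filterS => y yP; apply/forallP.
Qed.

End EllipticFaces.

(** * The projection onto the elliptic torus *)

Section ComplexTopology.
Variable R : realType.
Definition complexes : numFieldType := R[i].
Local Notation C := complexes.

Lemma real_complex_continuous : continuous (real_complex R : R -> C).
Proof.
move=> x; apply/cvgrPdist_lt => e e0.
have [eE e1] : e = (complex.Re e)%:C%C /\ 0 < complex.Re e.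
  move: e0; rewrite ltcE => /andP[/eqP eI er]; split=> //.
  by case: e eI {er} => ? ? /= ->.
exists (complex.Re e) => // t /= xt.
rewrite eE -rmorphB normc_def /= expr0n addr0 sqrtr_sqr.
by rewrite ltcR.
Qed.

Lemma Re_continuous : continuous (@complex.Re R : C -> R).
Proof.
move=> x P [e /= e0 eP]; exists e%:C%C => [|t /= xt]; first by rewrite /= ltcR.
apply: eP; move: xt; rewrite /= -raddfB -ltcR; apply: le_lt_trans.
exact: normc_ge_Re.
Qed.

Lemma Im_continuous : continuous (@complex.Im R : C -> R).
Proof.
move=> x P [e /= e0 eP]; exists e%:C%C => [|t /= xt]; first by rewrite /= ltcR.
apply: eP; move: xt; rewrite /= -raddfB -ltcR; apply: le_lt_trans.
rewrite normc_def lecR -sqrtr_sqr ler_sqrt ?addr_ge0 ?sqr_ge0//.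
by rewrite lerDr sqr_ge0.
Qed.

End ComplexTopology.

Lemma quotient_group_nbhs (K : numFieldType) (I : zmodClosed K) (x : K) (P : set K) :
  nbhs x P ->
  nbhs (\pi_(quotient_group I)%qT x) [set \pi_(quotient_group I)%qT y | y in P].
Proof.
rewrite nbhsE => -[O [oO Ox] OP].
apply: (@filterS _ _ _ [set \pi_(quotient_group I)%qT y | y in O]).
  by move=> _ [y Oy <-]; exists y => //; exact: OP.
apply: open_nbhs_nbhs; split; last by exists x.
rewrite /open /= /quotient_open.
rewrite (_ : _ @^-1` _ = \bigcup_(l in [set l | l \in I]) (fun y => y + l) @^-1` O).
  apply: bigcup_open => l _; apply: open_comp => // y _.
  by apply: (@continuousD K K K id (fun=> l)); [exact: cvg_id|exact: cst_continuous].
apply/seteqP; split=> [y [z Oz /quotient_groupP zy]|y [l lI Oyl]].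
  by exists (z - y) => //=; rewrite addrC subrK.
by exists (y + l) => //; apply/quotient_groupP; rewrite addrC addKr.
Qed.

Section EllipticProjection.
Variables (R : realType) (omega : R[i]).
Hypothesis omega_nonreal : omega \isn't Num.real.
Local Notation C := (complexes R).
Local Notation E := (elliptic_curve omega).

Definition complex_of (x y : R) : R[i] := x%:C%C + omega * y%:C%C.

Lemma complex_ofB x y x' y' :
  complex_of x y - complex_of x' y' = complex_of (x - x') (y - y').
Proof. by rewrite /complex_of !rmorphB mulrBr opprD addrACA. Qed.

Lemma complex_of_eq0 x y : complex_of x y = 0 -> x = 0 /\ y = 0.
Proof.
move=> xy; have y0 : y = 0.
  apply: contraNeq omega_nonreal => y0; apply/complex_realP; exists (- x / y).
  have yC : y%:C%C != 0 by rewrite (fmorph_eq0 (real_complex R)).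
  apply: (mulIf yC); rewrite -rmorphM /= divfK// rmorphN /=.
  by apply/eqP; rewrite -addr_eq0 addrC; apply/eqP.
split=> //; move: xy; rewrite /complex_of y0 mulr0 addr0 => /eqP.
by rewrite (fmorph_eq0 (real_complex R)) => /eqP.
Qed.

Lemma complex_of_lattice x y :
  (complex_of x y \in lattice omega) = (x \is a Num.int) && (y \is a Num.int).
Proof.
have lE (m k : int) : m%:~R + k%:~R * omega = complex_of m%:~R k%:~R.
  by rewrite /complex_of !rmorph_int mulrC.
apply/asboolP/andP => [[m [k]]|[/intrP[m ->] /intrP[k ->]]].
  rewrite lE => /eqP; rewrite -subr_eq0 complex_ofB => /eqP /complex_of_eq0[].
  by move=> /eqP; rewrite subr_eq0 => /eqP -> /eqP; rewrite subr_eq0 => /eqP ->.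
by exists m, k; rewrite lE.
Qed.

Lemma Im_omega : complex.Im omega != 0.
Proof.
apply: contraNneq omega_nonreal => w0; apply/complex_realP.
by exists (complex.Re omega); apply/eqP; rewrite eq_complex /= w0 !eqxx.
Qed.

Definition second_coord (t : R[i]) : R := complex.Im t / complex.Im omega.
Definition first_coord (t : R[i]) : R :=
  complex.Re t - complex.Re omega * second_coord t.

Lemma complex_of_coords t : complex_of (first_coord t) (second_coord t) = t.
Proof.
rewrite /complex_of /first_coord /second_coord.
have w0 := Im_omega; case: omega w0 t => a c /= c0 [u v] /=.
apply/eqP; rewrite eq_complex /= !mulr0 subr0 !add0r.
by rewrite subrK eqxx mulrCA divff// mulr1 eqxx.
Qed.

Lemma coords_complex_of x y :
  (first_coord (complex_of x y) = x) * (second_coord (complex_of x y) = y).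
Proof.
have /eqP := complex_of_coords (complex_of x y).
rewrite -subr_eq0 complex_ofB => /eqP /complex_of_eq0[/eqP + /eqP].
by rewrite !subr_eq0 => /eqP -> /eqP ->.
Qed.

Lemma second_coord_continuous : continuous (second_coord : C -> R).
Proof.
move=> t; apply: (@continuousM R C (@complex.Im R : C -> R)
  (fun=> (complex.Im omega)^-1)).
  exact: Im_continuous.
exact: cst_continuous.
Qed.

Lemma first_coord_continuous : continuous (first_coord : C -> R).
Proof.
move=> t; apply: (@continuousB R R C (@complex.Re R : C -> R)
  (fun t => complex.Re omega * second_coord t)); first exact: Re_continuous.
apply: (@continuousM R C (fun=> complex.Re omega) (second_coord : C -> R)).
  exact: cst_continuous.
exact: second_coord_continuous.
Qed.

Lemma complex_of_continuous (T : topologicalType) (f g : T -> R) x :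
  {for x, continuous f} -> {for x, continuous g} ->
  {for x, continuous (fun y => complex_of (f y) (g y) : C)}.
Proof.
have realc (h : T -> R) : {for x, continuous h} ->
    {for x, continuous (fun y => (h y)%:C%C : C)}.
  move=> hc; apply: (@continuous_comp _ _ _ h (real_complex R : R -> C)) => //.
  exact: real_complex_continuous.
move=> /realc fc /realc gc.
apply: (@continuousD C C T (fun y => (f y)%:C%C) (fun y => omega * (g y)%:C%C)).
  exact: fc.
apply: (@continuousM C T (fun=> omega) (fun y => (g y)%:C%C)); last exact: gc.
exact: cst_continuous.
Qed.

Section Projection.
Variable d : nat.
Local Notation W := 'rV[R]_(d + d).
Local Notation "''i' v" := (map_mx intr v : W) (at level 10, v at level 9).

Definition elliptic_projection (z : W) : 'rV[E]_d :=
  \row_k \pi_E%qT (complex_of (lsubmx z 0 k) (rsubmx z 0 k)).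
Local Notation pr := elliptic_projection.

Lemma elliptic_projection_eq y z : pr y = pr z <-> exists v, z = y + 'i v.
Proof.
split=> [/rowP yz|[v ->]].
  have H k : (lsubmx z 0 k - lsubmx y 0 k \is a Num.int) &&
             (rsubmx z 0 k - rsubmx y 0 k \is a Num.int).
    have := yz k; rewrite !mxE => /esym/quotient_groupP.
    by rewrite complex_ofB complex_of_lattice.
  have {H} /choice[f fP] (i : 'I_(d + d)) : exists m : int, z 0 i - y 0 i = m%:~R.
    rewrite -(splitK i); case: (fintype.split i) => k /=; have /andP[h1 h2] := H k;
    by move: h1 h2; rewrite !mxE => /intrP[m1 e1] /intrP[m2 e2]; eexists; eassumption.
  exists (\row_i f i); apply/rowP => i.
  by rewrite !mxE -fP addrC subrK.
apply/rowP => k; rewrite !mxE; apply/esym/quotient_groupP.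
by rewrite complex_ofB complex_of_lattice !(addrC (y _ _)) !addrK !intr_int.
Qed.

Lemma elliptic_projection_surj m : exists z, pr z = m.
Proof.
pose t k := repr (m 0 k).
exists (row_mx (\row_k first_coord (t k)) (\row_k second_coord (t k))).
apply/rowP => k; rewrite mxE row_mxKl row_mxKr !mxE complex_of_coords.
by rewrite reprK.
Qed.

Lemma elliptic_projection_continuous : continuous pr.
Proof.
move=> z; apply: (@cvg_row E d W (nbhs z)) => k.
under eq_cvg do rewrite mxE; rewrite mxE.
apply: (@continuous_comp W C E
  (fun z => complex_of (lsubmx z 0 k) (rsubmx z 0 k)) (\pi_E%qT)).
  apply: complex_of_continuous.
    rewrite (_ : (fun _ => _) = (fun y : W => y 0 (lshift d k))).
      exact: coord_continuous.
    by apply/funext => y; rewrite mxE.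
  rewrite (_ : (fun _ => _) = (fun y : W => y 0 (rshift d k))).
    exact: coord_continuous.
  by apply/funext => y; rewrite mxE.
exact: pi_continuous.
Qed.

Lemma elliptic_projection_nbhs z (P : set W) :
  nbhs z P -> nbhs (pr z) [set pr y | y in P].
Proof.
move=> [Q zQ QP].
pose B k : set C := [set t | Q 0 (lshift d k) (first_coord t) /\
                             Q 0 (rshift d k) (second_coord t)].
have nB k : nbhs (complex_of (lsubmx z 0 k) (rsubmx z 0 k) : C) (B k).
  apply: filterI.
    apply: first_coord_continuous; rewrite coords_complex_of mxE; exact: zQ.
  apply: second_coord_continuous; rewrite coords_complex_of mxE; exact: zQ.
exists (fun _ k => [set \pi_E%qT t | t in B k]).
  by move=> i k; rewrite mxE; apply: quotient_group_nbhs; exact: nB.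
move=> m /= mB; have /choice[t tP] (k : 'I_d) : exists t, B k t /\ \pi_E%qT t = m 0 k.
  by have [t Bt tm] := mB 0 k; exists t.
exists (row_mx (\row_k first_coord (t k)) (\row_k second_coord (t k))).
  apply: QP => i j; rewrite ord1 -(splitK j); case: (fintype.split j) => k /=.
    by rewrite row_mxEl mxE; exact: (tP k).1.1.
  by rewrite row_mxEr mxE; exact: (tP k).1.2.
apply/rowP => k; rewrite mxE row_mxKl row_mxKr !mxE complex_of_coords.
exact: (tP k).2.
Qed.

End Projection.
End EllipticProjection.

Lemma fst_continuous (X Y : topologicalType) : continuous (@fst X Y).
Proof. by move=> x; exact: cvg_fst. Qed.

Lemma snd_continuous (X Y : topologicalType) : continuous (@snd X Y).
Proof. by move=> x; exact: cvg_snd. Qed.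

Section HomotopyEquivalence.
Variables (R : realType) (omega : R[i]).
Hypothesis omega_nonreal : omega \isn't Num.real.
Variables (d n : nat) (A : 'M[int]_(d, n)) (b : 'I_n -> circle R).
Hypothesis A_rank : \rank (map_mx (intr : int -> rat) A) = d.
Local Notation W := 'rV[R]_(d + d).
Local Notation "''i' v" := (map_mx intr v : W) (at level 10, v at level 9).
Local Notation E := (elliptic_curve omega).
Local Notation K := (cell_pair_category b A_rank).
Local Notation M := (elliptic_complement A b omega).
Local Notation U := (disjoint_support A b).
Local Notation pr := (@elliptic_projection R omega d).
Local Notation off := (offset b).

Lemma elliptic_hypersurfaceP j (z : W) :
  elliptic_hypersurface A b omega j (pr z) <->
  (pos A off (lsubmx z) j \is a Num.int) && (pos A off (rsubmx z) j \is a Num.int).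
Proof.
have -> : elliptic_hypersurface A b omega j (pr z) =
    (\pi_E%qT (complex_of omega (character (col j A) (lsubmx z))
                         (character (col j A) (rsubmx z))) =
     \pi_E%qT (complex_of omega (repr (b j)) (repr (b j)))).
  rewrite /elliptic_hypersurface /=; congr (_ = _).
  rewrite /character /complex_of !rmorph_sum mulr_sumr -big_split raddf_sum.
  apply: eq_bigr => k _; rewrite mxE -raddfMz; congr (\pi_E%qT _).
  by rewrite /complex_of !rmorphMz mulrzDl mulrzAr.
rewrite quotient_groupP complex_ofB complex_of_lattice//.
by rewrite !pos_offset.
Qed.

Lemma elliptic_complementP (z : W) : M (pr z) <-> U z.
Proof.
split=> [Mz|/forallP Uz [j _ /elliptic_hypersurfaceP zj]].
  by apply/forallP => j; apply/negP => zj; apply: Mz; exists j => //;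
    apply/elliptic_hypersurfaceP.
by have := Uz j; rewrite zj.
Qed.

Variable m0 : M.

(* Junk value [m0] outside of the complement. *)
Definition complement_point (z : W) : M :=
  match pselect (M (pr z)) with
  | left h => SigSub (mem_set h)
  | right _ => m0
  end.
Local Notation mk := complement_point.

Lemma val_complement_point z : U z -> set_val (mk z) = pr z.
Proof.
by move=> /elliptic_complementP Uz; rewrite /mk; case: pselect.
Qed.

Lemma complement_point_translate z v : U z -> mk (z + 'i v) = mk z.
Proof.
move=> Uz; apply: val_inj; rewrite -!set_valE !val_complement_point//.
  by apply/esym/elliptic_projection_eq => //; exists v.
by rewrite disjoint_support_translate.
Qed.

Lemma complement_point_surj (m : M) : exists2 z, U z & m = mk z.
Proof.
have [z zm] := elliptic_projection_surj omega_nonreal (set_val m).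
have Uz : U z by apply/elliptic_complementP; rewrite zm; exact: set_valP.
exists z => //; apply: val_inj; rewrite -!set_valE val_complement_point//.
Qed.

Lemma complement_point_eq y z : U y -> U z -> mk y = mk z ->
  exists v, z = y + 'i v.
Proof.
move=> Uy Uz /(congr1 set_val); rewrite !val_complement_point//.
by move/elliptic_projection_eq; exact.
Qed.

Lemma complement_point_continuous z : U z -> {for z, continuous mk}.
Proof.
move=> Uz; apply: (@cvg_set_val _ _ W (nbhs z)); rewrite val_complement_point//.
apply: (@cvg_trans _ (pr y @[y --> nbhs z])).
  apply: near_eq_cvg.
  apply: (@filterS _ (nbhs z) _ _ _ _ (disjoint_support_near A_rank Uz)) => y Uy.
  by rewrite val_complement_point.
exact: elliptic_projection_continuous.
Qed.

Lemma complement_point_nbhs z (P : set W) : U z -> nbhs z P ->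
  nbhs (mk z) [set m | exists2 y, U y /\ P y & m = mk y].
Proof.
move=> Uz zP; have := elliptic_projection_nbhs omega_nonreal zP.
rewrite -val_complement_point// => /(@initial_continuous _ _ set_val) zQ.
apply: (@filterS _ (nbhs (mk z)) _ (set_val @^-1` [set pr y | y in P]) _ _ zQ).
move=> m [y Py ym]; exists y.
  by split=> //; apply/elliptic_complementP; rewrite ym; exact: set_valP.
apply: val_inj; rewrite -!set_valE val_complement_point//.
by apply/elliptic_complementP; rewrite ym; exact: set_valP.
Qed.

Lemma complement_continuous (T Y : topologicalType) (g : M * T -> Y) (h : W * T -> Y) :
  (forall z t, U z -> g (mk z, t) = h (z, t)) ->
  (forall z t, U z -> {for (z, t), continuous h}) -> continuous g.
Proof.
move=> gh hc [m t] N; have [z Uz ->] := complement_point_surj m.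
rewrite gh// => /(hc _ _ Uz) [[P Q] /= [zP tQ] PQ].
exists ([set m | exists2 y, U y /\ P y & m = mk y], Q).
  by split=> //=; exact: complement_point_nbhs.
move=> [_ u] /= [[y [Uy Py] ->] Qu]; rewrite gh//; exact: (PQ (y, u)).
Qed.

Definition clamp (t : R) : R := (`|t| - `|t - 1| + 1) / 2.

Lemma clamp_itv t : 0 <= clamp t <= 1.
Proof.
rewrite /clamp; have := ler_normD (t - 1) 1; rewrite subrK normr1 => h1.
have h2 : `|t - 1| <= `|t| + 1 by have := ler_normB t 1; rewrite normr1.
by apply/andP; split; lra.
Qed.

Lemma clamp01 : clamp 0 = 0 /\ clamp 1 = 1.
Proof.
by rewrite /clamp subrr normr0 normr1 !sub0r normrN1; split; lra.
Qed.

Lemma clamp_continuous : continuous clamp.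
Proof.
move=> t; apply: cvgM; last exact: cvg_cst.
apply: cvgD; last exact: cvg_cst.
apply: cvgB; first by apply: cvg_norm; exact: cvg_id.
by apply: cvg_norm; apply: cvgB; [exact: cvg_id|exact: cvg_cst].
Qed.

Definition push_path (z : W) (t : R) : W :=
  push b A_rank z + clamp t *: (z - push b A_rank z).

Lemma push_pathU z t : U z -> U (push_path z t).
Proof.
move=> Uz; have pz := push_same_face A_rank Uz.
have /andP[c0 c1] := clamp_itv t; rewrite /push_path.
have [->|cn0] := eqVneq (clamp t) 0.
  by rewrite scale0r addr0 (disjoint_support_same pz).
rewrite (disjoint_support_same (same_face_segment _ _)) //; last first.
  by rewrite lt_def cn0 c0.
by case/andP: pz.
Qed.

Lemma push_path_translate z v t : U z ->
  push_path (z + 'i v) t = push_path z t + 'i v.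
Proof.
move=> Uz; rewrite /push_path push_translate// opprD addrACA subrr addr0.
by rewrite addrAC.
Qed.

Lemma push_path_continuous z t : U z ->
  {for (z, t), continuous (fun zt : W * R => push_path zt.1 zt.2)}.
Proof.
move=> Uz.
have pc : {for (z, t), continuous (fun zt : W * R => push b A_rank zt.1)}.
  apply: (@continuous_comp _ _ _ fst (push b A_rank)); first exact: fst_continuous.
  exact: push_continuous.
rewrite /push_path; apply: (@continuousD R W (W * R)%type
  (fun zt => push b A_rank zt.1)
  (fun zt => clamp zt.2 *: (zt.1 - push b A_rank zt.1))); first exact: pc.
apply: (@continuousZ R W (W * R)%type (fun zt => clamp zt.2)
  (fun zt => zt.1 - push b A_rank zt.1)).
  apply: (@continuous_comp _ _ _ snd clamp); first exact: snd_continuous.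
  exact: clamp_continuous.
apply: (@continuousB R W (W * R)%type fst (fun zt => push b A_rank zt.1)).
  exact: fst_continuous.
exact: pc.
Qed.

Lemma homotopy_equivalent_complement (p0 : realization R K) :
  homotopy_equivalent R (realization R K) M.
Proof.
have [f [fE fc]] := @realization_lift R K M (fun p => mk (simplex_lift p))
  (fun p q pq => let: ex_intro v e := glued_lift pq in
    esym (etrans (congr1 mk e) (complement_point_translate v (simplex_liftP p0 p).1))).
have /choice[lift liftP] (m : M) : exists z, U z /\ m = mk z.
  by have [z Uz mz] := complement_point_surj m; exists z.
pose g m := retraction p0 (lift m).
have lift_mk z : U z -> exists v, lift (mk z) = z + 'i v.
  move=> Uz; have [Ul mE] := liftP (mk z).
  exact: complement_point_eq.
have gE z : U z -> g (mk z) = retraction p0 z.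
  move=> Uz; rewrite /g; have [v ->] := lift_mk z Uz.
  exact: retraction_translate.
have {}fc : continuous f.
  apply: fc => c t; apply: (@continuous_comp (simplex_of R c) W M
    (fun t => simplex_lift (existT (fun c => simplex_of R c : Type) c t)) mk).
    exact: simplex_lift_continuous.
  exact/complement_point_continuous/(simplex_liftP p0 _).1.
have frE z : U z -> f (retraction p0 z) = mk (push b A_rank z).
  move=> Uz; have [p [v [-> ->]]] := push_lift p0 Uz.
  by rewrite fE complement_point_translate//; exact: (simplex_liftP p0 p).1.
exists f, g; split=> //.
- have gc : continuous (fun mt : M * R => g mt.1).
    apply: (complement_continuous (h := fun zt => retraction p0 zt.1)).
      by move=> z t Uz; exact: gE.
    move=> z t Uz; apply: (@continuous_comp _ _ _ fst (retraction p0)).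
      exact: fst_continuous.
    exact: retraction_continuous.
  move=> m N /(gc (m, 0)) [[P Q] /= [mP tQ] PQ].
  apply: (@filterS _ (nbhs m) _ P _ _ mP) => x Px.
  by apply: (PQ (x, 0)); split=> //; exact: nbhs_singleton tQ.
- exists fst; split=> // [|p].
    exact/continuous_subspaceT/fst_continuous.
  rewrite -[p]reprK /= fE gE ?(simplex_liftP p0 _).2//.
  exact: (simplex_liftP p0 _).1.
- exists (fun mt => mk (push_path (lift mt.1) mt.2)); split=> [|m|m].
  + apply: continuous_subspaceT.
    apply: (complement_continuous (h := fun zt => mk (push_path zt.1 zt.2))).
      move=> z t Uz /=; have [v ->] := lift_mk z Uz.
      by rewrite push_path_translate// complement_point_translate//; exact: push_pathU.
    move=> z t Uz; apply: (@continuous_comp _ _ _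
      (fun zt : W * R => push_path zt.1 zt.2) mk).
      exact: push_path_continuous.
    exact/complement_point_continuous/push_pathU.
  + have [z Uz ->] := complement_point_surj m.
    rewrite /= gE// frE// /push_path clamp01.1 scale0r addr0.
    have [v ->] := lift_mk z Uz; rewrite push_translate// complement_point_translate//.
    by rewrite (disjoint_support_same (push_same_face A_rank Uz)).
  + have [_ mE] := liftP m; rewrite /= /push_path clamp01.2 scale1r addrC subrK.
    by rewrite -mE.
Qed.

End HomotopyEquivalence.

Lemma homotopy_equivalent_empty (R : realType) (X Y : topologicalType) :
  (X -> False) -> (Y -> False) -> homotopy_equivalent R X Y.
Proof.
move=> nX nY.
exists (fun x => False_rect Y (nX x)), (fun y => False_rect X (nY y)).
split; try by move=> x; first [case: (nX x)|case: (nY x)].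
  exists fst; split=> [|x|x]; try by case: (nX x).
  exact/continuous_subspaceT/fst_continuous.
exists fst; split=> [|y|y]; try by case: (nY y).
exact/continuous_subspaceT/fst_continuous.
Qed.

Theorem theorem3p8 (R : realType) (omega : R[i])
  (omega_nonreal : omega \isn't Num.real)
  (d n : nat) (A : 'M[int]_(d, n)) (b : 'I_n -> circle R)
  (A_rank : \rank (map_mx (intr : int -> rat) A) = d)
  (A_col : forall j : 'I_n, col j A != 0) :
  homotopy_equivalent R
    (realization R (cell_pair_category b A_rank))
    (elliptic_complement A b omega).
Proof.
have [[z Uz]|nU] := pselect (exists z, disjoint_support A b z).
  have [y [t _]] := vertices_carrier A_rank Uz.
  have Mz : elliptic_complement A b omega (elliptic_projection omega z).
    exact/elliptic_complementP.
  apply: homotopy_equivalent_complement => //.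
    by exists (elliptic_projection omega z); exact: mem_set.
  exact: (lifted_point A_rank y [::] (fun=> 1)).
apply: homotopy_equivalent_empty => [p|m].
  have [x _] := vertex_ob_surj (sval (projT1 (repr p))).1.
  by apply: nU; exists (val x); exact: vertexU.
have [z zm] := elliptic_projection_surj omega_nonreal (set_val m).
apply: nU; exists z; apply/(elliptic_complementP omega_nonreal).
by rewrite zm; exact: set_valP.
Qed.
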